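(* Let $C$ be a nonempty convex weakly compact subset of a nearly uniformly noncreasy Banach space $X$. Then every continuous mapping $T:C\to C$ which satisfies condition $(C_\lambda)$ for some $\lambda\in(0,1)$ has a fixed point. Moreover, the assumption of continuity of $T$ can be dropped if $T$ satisfies condition $(C)$; that is, every mapping $T:C\to C$ satisfying condition $(C)$ has a fixed point.
   Context: For $\lambda\in(0,1)$, a mapping $T:C\to X$ satisfies condition $(C_\lambda)$ if for all $x,y\in C$: $\lambda\|x-Tx\|\le\|x-y\|$ implies $\|Tx-Ty\|\le\|x-y\|$. Condition $(C)$ is condition $(C_{1/2})$. $S_X$ denotes the unit sphere of $X$. A Banach space has the Schur property if every weakly convergent sequence in it converges in norm. For a Banach space $X$ without the Schur property, $x\in X$ and $\varepsilon\ge 0$, define $$d(\varepsilon,x)=\inf\Big\{\limsup_{n\to\infty}\|x+\varepsilon y_n\|-\|x\| : (y_n)\text{ is a weakly null sequence in }S_X\Big\},$$ $$b(\varepsilon,x)=\sup\Big\{\liminf_{n\to\infty}\|x+\varepsilon y_n\|-\|x\| : (y_n)\text{ is a weakly null sequence in }S_X\Big\}.$$ A Banach space $X$ is nearly uniformly noncreasy (NUNC) if it has the Schur property or, for every $\varepsilon>0$, there is $t>0$ such that for every $x\in S_X$, $d(\varepsilon,x)\ge t$ or $b(t,x)\le\varepsilon t$. *)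

(* Defs.v *)
From HB Require Import structures.
From mathcomp Require Import all_boot all_order all_algebra.
From mathcomp Require Import all_classical all_reals all_analysis.

Set Implicit Arguments.
Unset Strict Implicit.
Unset Printing Implicit Defensive.

Import Order.TTheory GRing.Theory Num.Theory.
Import numFieldNormedType.Exports.

Local Open Scope classical_set_scope.
Local Open Scope ring_scope.

Definition dual (R : realType) (X : normedModType R) : Type :=
  {f : {linear X -> R^o} | continuous f}.

(* X with its weak topology: the coarsest one making all elements of the
   dual continuous. It is an alias of X, so that x : X can be cast to it. *)
Definition weak (R : realType) (X : normedModType R) : Type :=
  sup_topology (fun f : dual X =>
    Topological.class (initial_topology (sval f : X -> R^o))).

HB.instance Definition _ (R : realType) (X : normedModType R) :=
  Topological.copy (weak X) (sup_topology (fun f : dual X =>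
    Topological.class (initial_topology (sval f : X -> R^o)))).

Definition weakly_compact (R : realType) (X : normedModType R) (A : set X) :=
  compact (A : set (weak X)).

Definition weakly_cvg_to (R : realType) (X : normedModType R)
    (u : nat -> X) (l : X) : Prop :=
  (u : nat -> weak X) @ \oo --> (l : weak X).

Definition schur_property (R : realType) (X : normedModType R) : Prop :=
  forall u : nat -> X, (exists l, weakly_cvg_to u l) -> cvgn u.

Definition unit_sphere (R : realType) (X : normedModType R) : set X :=
  [set x | `|x| = 1].

Arguments unit_sphere {R} X _.

Definition weakly_null_sphere_seq (R : realType) (X : normedModType R) :
    set (nat -> X) :=
  [set y | (forall n, unit_sphere X (y n)) /\ weakly_cvg_to y 0].

Arguments weakly_null_sphere_seq {R} X _.

(* The two moduli are valued in \bar R. The limits superior and inferior are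
   finite (the sequences are bounded), and so are the moduli as soon as X has
   a weakly null sequence in its unit sphere, i.e. when X does not have the
   Schur property. *)
Definition d_modulus (R : realType) (X : normedModType R) (eps : R) (x : X)
    : \bar R :=
  ereal_inf [set ((limn_esup (fun n => `|x + eps *: y n|%:E) - `|x|%:E)%E : \bar R)
            | y in weakly_null_sphere_seq X].

Definition b_modulus (R : realType) (X : normedModType R) (eps : R) (x : X)
    : \bar R :=
  ereal_sup [set ((limn_einf (fun n => `|x + eps *: y n|%:E) - `|x|%:E)%E : \bar R)
            | y in weakly_null_sphere_seq X].

Definition nearly_uniformly_noncreasy (R : realType) (X : normedModType R)
    : Prop :=
  schur_property X \/
  forall eps : R, 0 < eps -> exists2 t : R, 0 < t &
    forall x, unit_sphere X x ->
      (t%:E <= d_modulus eps x)%E \/ (b_modulus t x <= (eps * t)%:E)%E.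

(* A mapping C -> X is given by a total function, constrained only on C. *)
Definition condition_C_ (R : realType) (X : normedModType R) (lambda : R)
    (C : set X) (T : X -> X) : Prop :=
  forall x y, C x -> C y ->
    lambda * `|x - T x| <= `|x - y| -> `|T x - T y| <= `|x - y|.

Definition condition_C (R : realType) (X : normedModType R)
    (C : set X) (T : X -> X) : Prop := condition_C_ 2^-1 C T.

(* Main.v *)
Require Import Defs.
From HB Require Import structures.
From mathcomp Require Import all_boot all_order all_algebra.
From mathcomp Require Import all_classical all_reals all_analysis.
From mathcomp Require Import ring lra.

Import Order.TTheory GRing.Theory Num.Theory.
Import numFieldNormedType.Exports.

Local Open Scope classical_set_scope.
Local Open Scope ring_scope.

(** Suppose that [T] has no fixed point. By weak compactness and Zorn's lemma
    there is a minimal nonempty closed convex [T]-invariant set [K]. For a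
    sequence [x] in [K] with [|x n - T (x n)| -> 0], each sublevel set in [K] of
    [y |-> limsup |x n - y|] is closed, convex and invariant, hence empty or
    equal to [K] ([asymptotic_ball_full]). This yields a radius [rho > 0] and
    such a sequence [x] with [|x n - y| -> rho] for all [y] in [K], while points
    [u] of [K] of small displacement [|u - T u|] stay at distance almost [rho] at
    least from any given point of [K] ([minimal_radius]). By the Eberlein-Smulian theorem one
    may assume that [x] converges weakly, say to [q].

    In a space with the Schur property this convergence is in norm and the
    limit is fixed by [T]. Otherwise, for each [0 < tau <= rho] one builds a
    sequence [z] in [K] of small displacement with, approximately,
    [|z n - z m| <= tau] and [|z n - x n| <= rho - tau] ([spread_all]). After
    passing to a subsequence, [z] has a weak limit [l]. Put [a = l - q].
    - The vectors [z n - l] are weakly null of norm about [tau], [a] has norm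
      about [rho - tau], and [a + (z n - l)] has norm about [rho]: in the
      direction [a] the norm grows at full speed along a weakly null sequence,
      so the modulus [b] is large.
    - The vectors [(z n - l) - (x n - q)] are weakly null of norm at least about
      [rho - tau], and adding them to [a] gives [z n - x n], of norm at most
      about [rho - tau]: along another weakly null sequence the norm does not
      grow at all, so the modulus [d] is small.
    For a suitable ratio [tau / (rho - tau)] this contradicts the condition
    defining nearly uniformly noncreasy spaces ([noncreasy_spread_false]).

    The sequence [z] starts as [x] and is moved towards one of its own terms by
    small proportions; after each move, iterates of the averaged map
    [(1 - c) I + c T] make the displacement small again, because they are
    asymptotically regular uniformly on bounded sets
    ([uniform_asymptotic_regularity], by the Goebel-Kirk inequality). The
    condition on [T] compares the images of two points only when their distance
    is not small relative to the displacement of one of them. The moves are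
    small so that the displacement never exceeds a fixed fraction of the
    distances to be controlled ([spread_step]).

    Continuity of [T], or Suzuki's inequality under condition (C), serves for
    one purpose: a norm limit of points whose displacement tends to zero is a
    fixed point ([displacement_closed]). *)

(** * The Hahn-Banach theorem *)
Section HahnBanach.
Context {R : realType} {X : lmodType R} (p : X -> R).
Hypothesis p0 : p 0 = 0.
Hypothesis p_convex : forall (a : R) x y, 0 <= a <= 1 ->
  p (a *: x + (1 - a) *: y) <= a * p x + (1 - a) * p y.

(** Partial linear functionals dominated by [p] are encoded as linear subspaces
    of [X * R]; the bound by [p] and [p 0 = 0] force such a subspace to be the
    graph of a function. The empty set is included, as the union of the empty
    chain. *)
Definition dominated_graph (G : set (X * R)) : Prop :=
  (forall k x r y s, G (x, r) -> G (y, s) -> G (k *: x + y, k * r + s)) /\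
  (forall x r, G (x, r) -> r <= p x).

(** The values allowed at [v] by the points [x - t v] lie below those allowed by
    the points [y + s v], because [p] is convex; their supremum is a valid
    value. *)
Lemma dominated_graph_ext (G : set (X * R)) (v : X) :
  dominated_graph G -> G (0, 0) ->
  exists a, dominated_graph
    [set z | exists x r k, G (x, r) /\ z = (x + k *: v, r + k * a)].
Proof.
move=> [Glin Gp] G0.
have Gscale k x r : G (x, r) -> G (k *: x, k * r).
  by move=> Gx; have := Glin k x r 0 0 Gx G0; rewrite !addr0.
pose A := [set b | exists x r t, [/\ G (x, r), 0 < t &
                                  b = (r - p (x - t *: v)) / t]].
(* both sides are compared at a point of the segment joining x - t v and
   y + s v, which lies in the domain of G *)
have Aub y q s : G (y, q) -> 0 < s -> ubound A ((p (y + s *: v) - q) / s).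
  move=> Gy s0 _ [x [r [t [Gx t0 ->]]]].
  rewrite ler_pdivrMr // mulrAC ler_pdivlMr //.
  have st : 0 < s + t by lra.
  have := p_convex (s / (s + t)) (x - t *: v) (y + s *: v).
  have st1 : s / (s + t) <= 1 by rewrite ler_pdivrMr // mul1r; lra.
  have st0 : 0 <= s / (s + t) by rewrite divr_ge0 //; lra.
  rewrite st0 st1 => /(_ isT).
  have e1 : 1 - s / (s + t) = t / (s + t) by field; rewrite gt_eqF.
  rewrite e1.
  have -> : (s / (s + t)) *: (x - t *: v) + (t / (s + t)) *: (y + s *: v) =
            (s / (s + t)) *: x + (t / (s + t)) *: y.
    rewrite !scalerDr scalerN !scalerA addrACA.
    have -> : t / (s + t) * s = s / (s + t) * t by ring.
    by rewrite addNr addr0.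
  have := Gp _ _ (Glin (s / (s + t)) _ _ _ _ Gx (Gscale (t / (s + t)) _ _ Gy)).
  move=> /le_trans h /h.
  have -> : s / (s + t) * r + t / (s + t) * q = (s * r + t * q) / (s + t).
    by field; rewrite gt_eqF.
  have -> : s / (s + t) * p (x - t *: v) + t / (s + t) * p (y + s *: v) =
      (s * p (x - t *: v) + t * p (y + s *: v)) / (s + t).
    by field; rewrite gt_eqF.
  rewrite ler_pdivrMr // divfK ?gt_eqF //.
  lra.
have A0 : A !=set0 by exists ((0 - p (0 - 1 *: v)) / 1), 0, 0, 1.
have hsA : has_sup A by split=> //; exists ((p (0 + 1 *: v) - 0) / 1); exact: Aub.
exists (sup A); split.
  move=> k _ _ _ _ [x [r [m [Gx [-> ->]]]]] [y [s [n [Gy [-> ->]]]]].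
  exists (k *: x + y), (k * r + s), (k * m + n); split; first exact: Glin.
  congr pair; last by ring.
  by rewrite scalerDr scalerDl scalerA addrACA.
move=> _ _ [x [r [k [Gx [-> ->]]]]].
have [k0|k0|->] := ltgtP k 0; last by rewrite scale0r mul0r !addr0; exact: Gp.
- have : (r - p (x - (- k) *: v)) / (- k) <= sup A.
    by apply: ub_le_sup => //; [case: hsA|exists x, r, (- k); split=> //; lra].
  by rewrite ler_pdivrMr ?oppr_gt0 // scaleNr opprK; lra.
- have : sup A <= (p (x + k *: v) - r) / k.
    by apply: ge_sup => //; exact: Aub.
  by rewrite ler_pdivlMr //; lra.
Qed.

(** Only convexity is asked of [p], rather than sublinearity: the distance to a
    convex set, recentred at a point, can then be used directly. *)
Lemma hahn_banach_convex :
  exists f : {linear X -> R^o}, forall x, f x <= p x.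
Proof.
have [F FP Ftot|G [[Glin Gp] Gmax]] := @Zorn_bigcup _ dominated_graph.
  split=> [k x r y s [A FA Ax] [B FB By]|x r [A FA]]; last exact: (FP _ FA).2.
  have [AB|BA] := Ftot _ _ FA FB.
  - by exists B => //; apply: (FP _ FB).1 => //; exact: AB.
  - by exists A => //; apply: (FP _ FA).1 => //; exact: BA.
have G00 : G (0, 0).
  have [[[x r] Gxr]|Gnot] := pselect (exists z, G z).
    by have := Glin (-1) _ _ _ _ Gxr Gxr; rewrite scaleN1r addNr mulN1r addNr.
  exfalso; apply: (Gmax [set (0, 0)]).
    split=> [z Gz|]; first by exfalso; apply: Gnot; exists z.
    by move=> /(_ (0, 0) erefl) G0; apply: Gnot; exists (0, 0).
  split=> [k x r y s [-> ->] [-> ->]|x r [-> ->]]; last by rewrite p0.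
  by rewrite scaler0 mulr0 !addr0.
have Gscale k x r : G (x, r) -> G (k *: x, k * r).
  by move=> Gx; have := Glin k x r 0 0 Gx G00; rewrite !addr0.
have Gtot v : exists r, G (v, r).
  apply: contrapT => nv.
  have [a G'P] := dominated_graph_ext G v (conj Glin Gp) G00.
  apply: Gmax G'P; split=> [[x r] Gx|].
    by exists x, r, 0; split=> //; rewrite scale0r mul0r !addr0.
  move=> /(_ (v, a)) G'v; apply: nv; exists a; apply: G'v.
  by exists 0, 0, 1; split=> //; rewrite scale1r mul1r !add0r.
(* a vertical line in the graph would contradict the bound by p 0 *)
have G0 r : G (0, r) -> r = 0.
  move=> Gr; apply/eqP; rewrite eq_le.
  have := Gp _ _ Gr; have := Gp _ _ (Gscale (-1) _ _ Gr).
  by rewrite scaler0 p0 => h1 h2; apply/andP; split; lra.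
have Guniq x r s : G (x, r) -> G (x, s) -> r = s.
  move=> Gr Gs; apply/eqP; rewrite -subr_eq0; apply/eqP/G0.
  by have := Glin (-1) _ _ _ _ Gs Gr; rewrite scaleN1r addNr mulN1r addrC.
have [f Gf] := choice Gtot.
have flin : linear (f : X -> R^o).
  by move=> k x y; apply: Guniq (Gf _) _; exact: Glin.
pose F : {linear X -> R^o} :=
  HB.pack (f : X -> R^o) (GRing.isLinear.Build _ _ _ _ (f : X -> R^o) flin).
by exists F => x; apply: Gp; exact: Gf.
Qed.
End HahnBanach.

(** * Continuous functionals and separation *)
Section Dual.
Context {R : realType} {X : normedModType R}.
Implicit Types (e r : R) (f : dual X) (x y : X).

(** The codomain of an element of the dual is [R^o]; here its values are real
    numbers. *)
Definition ev f x : R := sval f x.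

Lemma evD f : {morph ev f : x y / x + y}.
Proof. by move=> x y; rewrite /ev linearD. Qed.

Lemma evB f : {morph ev f : x y / x - y}.
Proof. by move=> x y; rewrite /ev linearB. Qed.

Lemma evN f : {morph ev f : x / - x}.
Proof. by move=> x; rewrite /ev linearN. Qed.

Lemma evZ f (a : R) x : ev f (a *: x) = a * ev f x.
Proof. by rewrite /ev linearZ. Qed.

Lemma dual_bounded f : exists2 M, 0 < M & forall x, `|ev f x| <= M * `|x|.
Proof.
have /linear_bounded_continuous/linear_boundedP/pinfty_ex_gt0[M M0 fM] := svalP f.
by exists M.
Qed.

Lemma dual_of_bounded (f : {linear X -> R^o}) (M : R) :
  (forall x, `|f x| <= M * `|x|) -> exists F : dual X, ev F = f.
Proof.
move=> fM; suff fc : continuous f by exists (exist _ f fc).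
apply/linear_bounded_continuous/linear_boundedP.
near=> r => x; apply: le_trans (fM x) _.
by apply: ler_wpM2r => //; near: r; exact: nbhs_pinfty_ge.
Unshelve. all: by end_near. Qed.

(** A convex 1-Lipschitz function has a subgradient of norm at most 1 at every
    point [u]: the convex function [h |-> phi (u + h) - phi u] vanishes at 0 and
    dominates a linear functional. *)
Lemma subgradient (phi : X -> R) u :
  (forall (a : R) x y, 0 <= a <= 1 ->
    phi (a *: x + (1 - a) *: y) <= a * phi x + (1 - a) * phi y) ->
  (forall x y, phi x - phi y <= `|x - y|) ->
  exists f, (forall x, `|ev f x| <= `|x|) /\
            forall x, ev f (x - u) <= phi x - phi u.
Proof.
move=> phiC phiL.
have [||f fp] := @hahn_banach_convex R X (fun h => phi (u + h) - phi u).
- by rewrite addr0 subrr.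
- move=> a x y a01.
  have := phiC a (u + x) (u + y) a01.
  have -> : a *: (u + x) + (1 - a) *: (u + y) = u + (a *: x + (1 - a) *: y).
    by rewrite !scalerDr addrACA -scalerDl [a + _]addrC subrK scale1r.
  by lra.
have fle x : f x <= `|x|.
  by apply: le_trans (fp x) _; apply: le_trans (phiL _ _) _; rewrite addrC addKr.
have fn x : `|f x| <= 1 * `|x|.
  rewrite mul1r ler_norml fle andbT lerNl.
  by have := fle (- x); rewrite linearN normrN.
have [F Ff] := dual_of_bounded f 1 fn.
exists F; split=> x; first by rewrite Ff -[leRHS]mul1r.
by rewrite Ff; apply: le_trans (fp _) _; rewrite [u + _]addrC subrK.
Qed.

(** A subgradient of the norm at [x]. *)
Lemma norming x : exists2 f, (forall y, `|ev f y| <= `|y|) & ev f x = `|x|.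
Proof.
have [||f [f1 fx]] := @subgradient (fun y => `|y|) x.
- move=> a y z /andP[a0 a1]; apply: le_trans (ler_normD _ _) _.
  by rewrite !normrZ !ger0_norm //; lra.
- by move=> y z; exact: lerB_dist.
exists f => //; apply/eqP; rewrite eq_le; apply/andP; split.
  by apply: le_trans (f1 x); exact: ler_norm.
by have := fx 0; rewrite normr0 !sub0r evN lerN2.
Qed.

Lemma ev_inj x y : (forall f, ev f x = ev f y) -> x = y.
Proof.
move=> xy; have [f _ fxy] := norming (x - y).
by apply/eqP; rewrite -subr_eq0 -normr_eq0 -fxy evB xy subrr.
Qed.

Definition convex_subset (A : set X) : Prop :=
  forall (a : R) x y, 0 <= a <= 1 -> A x -> A y -> A (a *: x + (1 - a) *: y).

Lemma convex_setP (A : set X) :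
  convex_set (A : set (convex_lmodType X)) <-> convex_subset A.
Proof.
split=> [cA a x y /andP[a0 a1] Ax Ay|cA x y l].
  have /= := cA x y (Itv01 a0 a1) (mem_set Ax) (mem_set Ay).
  by move/set_mem.
rewrite !inE => Ax Ay.
have l01 : 0 <= l%:num <= 1 by rewrite ge0 le1.
exact: (cA (l%:num) x y l01 Ax Ay).
Qed.

(** A subgradient at [u] of the distance to [F] drops from [u] to any point of
    [F] by at least the distance of [u] to [F]. *)
Lemma separation (F : set X) u :
  convex_subset F -> F !=set0 -> closed F -> ~ F u ->
  exists f, exists2 e, 0 < e & forall x, F x -> ev f x + e <= ev f u.
Proof.
move=> Fconv [x0 Fx0] Fcl nFu.
pose D x := [set `|x - y| | y in F].
pose phi x := inf (D x).
have D0 x : D x !=set0 by exists `|x - x0|, x0.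
have lbD x : lbound (D x) 0 by move=> _ [y _ <-].
have hiD x : has_inf (D x) by split=> //; exists 0.
have phi_le x y : F y -> phi x <= `|x - y|.
  by move=> Fy; apply: ge_inf; [exists 0|exists y].
have phi_near x e : 0 < e -> exists2 y, F y & `|x - y| < phi x + e.
  by move=> e0; have [_ [y Fy <-] ye] := inf_adherent e0 (hiD x); exists y.
have phi_ge0 x : 0 <= phi x by apply: lb_le_inf.
have phiF x : F x -> phi x = 0.
  move=> Fx; apply/eqP; rewrite eq_le phi_ge0 andbT.
  by have := phi_le x x Fx; rewrite subrr normr0.
have phiu : 0 < phi u.
  rewrite lt_neqAle phi_ge0 andbT eq_sym; apply/eqP => phiu0; apply: nFu.
  apply: Fcl => B /nbhs_ballP[e /= e0 eB].
  have [y Fy uy] := phi_near u e e0; exists y; split=> //; apply: eB.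
  by rewrite -ball_normE /=; rewrite phiu0 add0r in uy.
have [||f [f1 fu]] := @subgradient phi u.
- move=> a x y /andP[a0 a1]; apply/ler_addgt0Pr => e e0.
  have [x' Fx' xx'] := phi_near x e e0; have [y' Fy' yy'] := phi_near y e e0.
  have a01 : 0 <= a <= 1 by rewrite a0.
  apply: le_trans (phi_le _ _ (Fconv a x' y' a01 Fx' Fy')) _.
  have -> : a *: x + (1 - a) *: y - (a *: x' + (1 - a) *: y') =
            a *: (x - x') + (1 - a) *: (y - y').
    by rewrite !scalerBr opprD addrACA.
  apply: le_trans (ler_normD _ _) _; rewrite !normrZ !ger0_norm ?subr_ge0 //.
  have h1 : a * `|x - x'| <= a * (phi x + e) by apply: ler_wpM2l => //; exact: ltW.
  have h2 : (1 - a) * `|y - y'| <= (1 - a) * (phi y + e).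
    by apply: ler_wpM2l; [rewrite subr_ge0|exact: ltW].
  lra.
- move=> x y; rewrite lerBlDr; apply/ler_addgt0Pr => e e0.
  have [y' Fy' yy'] := phi_near y e e0.
  apply: le_trans (phi_le x y' Fy') _.
  have -> : x - y' = (x - y) + (y - y') by rewrite addrA subrK.
  by apply: le_trans (ler_normD _ _) _; lra.
exists f, (phi u) => // x Fx.
by have := fu x; rewrite evB (phiF x Fx); lra.
Qed.
End Dual.

(** * The weak topology *)
Section WeakTopology.
Context {R : realType} {X : normedModType R}.
Implicit Types (e r : R) (f : dual X) (C F : set X) (u v : nat -> X) (l m : X).

Lemma cvg_normP u (l : X) : u @ \oo --> l <->
  forall e, 0 < e -> \forall n \near \oo, `|u n - l| < e.
Proof.
split=> [/cvgrPdist_lt ul e e0|ul].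
  by apply: filterS (ul e e0) => n; rewrite distrC.
apply/cvgrPdist_lt => e e0; apply: filterS (ul e e0) => n.
by rewrite distrC.
Qed.

Lemma weak_nbhs f (l : X) e : 0 < e ->
  nbhs (l : weak X) [set y | `|ev f (y - l)| < e].
Proof.
move=> e0.
have h : nbhs (l : weak X) --> (l : weak X) by [].
move/cvg_sup: h => /(_ f) h.
apply: h.
have := @initial_continuous X R^o (sval f : X -> R^o) l.
move=> /(_ (ball (sval f l : R^o) e)) /=.
move=> /(_ (nbhsx_ballx _ _ e0)).
apply: (@filterS _ (nbhs (l : initial_topology (sval f : X -> R^o)))) => y.
by rewrite /= -ball_normE /= /ev linearB distrC.
Qed.

Lemma weakly_cvgP u (l : X) : weakly_cvg_to u l <->
  forall f e, 0 < e -> \forall n \near \oo, `|ev f (u n - l)| < e.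
Proof.
split=> [ul f e e0|ul].
  have V := weak_nbhs f l e e0.
  exact: (ul _ V).
have [_ +] := @cvg_sup X (dual X) (fun f =>
  Topological.class (initial_topology (sval f : X -> R^o))) (u @ \oo) l _.
apply=> f A [_ [[B Bop <-] Bfl BA]].
have := open_nbhs_nbhs (conj Bop Bfl) => /nbhs_ballP[e /= e0 eB].
apply: filterS (ul f e e0) => n fn; apply: BA; apply: eB.
by rewrite -ball_normE /= distrC -linearB.
Qed.

(** The basic weak neighbourhoods of a point are given by finitely many
    functionals, taken here as an initial segment of a sequence. *)
Lemma weakly_compact_cluster C u : weakly_compact C -> (forall n, C (u n)) ->
  exists2 l, C l & forall (g : nat -> dual X) k (e : R) N, 0 < e ->
    exists2 n, (N <= n)%N & forall j, (j < k)%N -> `|ev (g j) (u n - l)| < e.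
Proof.
move=> Ccpt Cu.
have [|l [Cl ul]] := Ccpt ((u : nat -> weak X) @ \oo) _.
  by exists 0%N => // n _; exact: Cu.
exists l => // g k e N e0.
have V : nbhs (l : weak X)
    [set y | forall j, (j < k)%N -> `|ev (g j) (y - l)| < e].
  elim: k => [|k IH]; first by apply: filterS filterT.
  apply: filterS2 IH (weak_nbhs (g k) l e e0) => y IH yk j.
  by rewrite ltnS leq_eqVlt => /orP[/eqP->|/IH].
have [|_ [[n Nn <-] Vn]] := ul (u @` [set n | (N <= n)%N]) _ _ V.
  by exists N => // n Nn; exists n.
by exists n.
Qed.

(** Closed convex sets are weakly closed, so the members of the chain have the
    finite intersection property for a compact topology. *)
Lemma weakly_compact_chain C (G : set (set X)) : weakly_compact C ->
  G !=set0 -> total_on G subset ->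
  (forall A, G A -> [/\ A `<=` C, A !=set0, closed A & convex_subset A]) ->
  \bigcap_(A in G) A !=set0.
Proof.
move=> Ccpt [A0 GA0] Gtot GP.
have FF : ProperFilter (filter_from G id : set_system (weak X)).
  apply: filter_from_proper; last by move=> A /GP[].
  apply: filter_from_filter; first by exists A0.
  move=> A B GA GB; have [AB|BA] := Gtot _ _ GA GB.
  - by exists A => // x Ax; split=> //; exact: AB.
  - by exists B => // x Bx; split=> //; exact: BA.
have [|l [Cl ul]] := Ccpt _ FF; first by exists A0 => //; case: (GP _ GA0).
exists l => A GA; apply: contrapT => nAl.
have [AC An0 Acl Acv] := GP _ GA.
have [f [e e0 fe]] := separation A l Acv An0 Acl nAl.
have [|x [Ax /= xl]] := ul A _ _ (weak_nbhs f l e e0); first by exists A.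
have := fe _ Ax; move: xl; rewrite evB ltr_norml => /andP[]; lra.
Qed.

Lemma cvg_weakly u l : u @ \oo --> l -> weakly_cvg_to u l.
Proof.
move=> ul; apply/weakly_cvgP => f e e0.
have [M M0 fM] := dual_bounded f.
have eM : 0 < e / M by rewrite divr_gt0.
move/cvg_normP: ul => /(_ _ eM); apply: filterS => n; rewrite ltr_pdivlMr // mulrC.
exact: le_lt_trans (fM _).
Qed.

(** Mazur's theorem, for sequences: a functional separating [l] from [F] would
    keep the sequence away from [l]. *)
Lemma weakly_cvg_convex F u l : convex_subset F -> closed F ->
  (\forall n \near \oo, F (u n)) -> weakly_cvg_to u l -> F l.
Proof.
move=> Fcv Fcl Fu /weakly_cvgP ul; apply: contrapT => nFl.
have [n0 Fn0] := filter_ex Fu.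
have [|f [e e0 fe]] := separation F l Fcv _ Fcl nFl; first by exists (u n0).
have [n [Fn]] := filter_ex (filterI Fu (ul f e e0)).
by have := fe _ Fn; rewrite evB ltr_norml => ? /andP[]; lra.
Qed.

Lemma convex_ball (y : X) r : convex_subset [set x | `|x - y| <= r].
Proof.
move=> a x x' /andP[a0 a1] /= hx hx'.
have -> : a *: x + (1 - a) *: x' - y = a *: (x - y) + (1 - a) *: (x' - y).
  by rewrite !scalerBr addrACA -opprD -scalerDl [a + _]addrC subrK scale1r.
apply: le_trans (ler_normD _ _) _; rewrite !normrZ !ger0_norm ?subr_ge0 //.
have h1 : a * `|x - y| <= a * r by exact: ler_wpM2l.
have h2 : (1 - a) * `|x' - y| <= (1 - a) * r by apply: ler_wpM2l; rewrite ?subr_ge0.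
lra.
Qed.

Lemma closed_cvg_seq F :
  (forall (u : nat -> X) l, (forall n, F (u n)) -> u @ \oo --> l -> F l) -> closed F.
Proof.
move=> Fseq l Fl.
have h n : exists y, F y /\ `|l - y| < n.+1%:R^-1.
  have n0 : (0 : R) < n.+1%:R^-1 by rewrite invr_gt0.
  have [y [Fy ly]] := Fl _ (nbhsx_ballx l _ n0).
  by exists y; split=> //; move: ly; rewrite -ball_normE.
have [u uP] := choice h.
apply: (Fseq u) => [n|]; first exact: (uP n).1.
apply/cvg_normP => e e0; near=> n; rewrite distrC.
apply: lt_trans (uP n).2 _.
by near: n; exact: near_infty_natSinv_lt (PosNum e0).
Unshelve. all: by end_near. Qed.

Lemma closed_normball (y : X) r : closed [set x | `|x - y| <= r].
Proof.
apply: closed_cvg_seq => u l Fu ul /=; apply/ler_addgt0Pr => e e0.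
move/cvg_normP: ul => /(_ _ e0)/filter_ex[n]; rewrite distrC => ln.
have /= un := Fu n.
have -> : l - y = (l - u n) + (u n - y) by rewrite addrA subrK.
by apply: le_trans (ler_normD _ _) _; lra.
Qed.

(** Weak lower semicontinuity of the norm. *)
Lemma weakly_cvg_norm_le u l y r : weakly_cvg_to u l ->
  (\forall n \near \oo, `|u n - y| <= r) -> `|l - y| <= r.
Proof.
move=> ul ur.
exact: (weakly_cvg_convex _ _ _ (convex_ball y r) (closed_normball y r) ur ul).
Qed.

Lemma weakly_cvgB u v l m :
  weakly_cvg_to u l -> weakly_cvg_to v m ->
  weakly_cvg_to (fun n => u n - v n) (l - m).
Proof.
move=> /weakly_cvgP ul /weakly_cvgP vm; apply/weakly_cvgP => f e e0.
have e20 : 0 < e / 2 by rewrite divr_gt0.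
apply: filterS2 (ul f _ e20) (vm f _ e20) => n /=.
by rewrite !evB !ltr_norml => /andP[? ?] /andP[? ?]; lra.
Qed.

Lemma weakly_cvg_cst l : weakly_cvg_to (fun=> l) l.
Proof. by apply: cvg_weakly; exact: cvg_cst. Qed.

Lemma weakly_cvg_sub u l (phi : nat -> nat) : (forall n, (n <= phi n)%N) ->
  weakly_cvg_to u l -> weakly_cvg_to (u \o phi) l.
Proof.
move=> phin /weakly_cvgP ul; apply/weakly_cvgP => f e e0.
have [N _ Nu] := ul f e e0; exists N => // n Nn.
by apply: Nu; apply: leq_trans (phin n).
Qed.

Lemma weakly_cvg_normalize u c : 0 < c -> (forall n, c <= `|u n|) ->
  weakly_cvg_to u 0 -> weakly_cvg_to (fun n => `|u n|^-1 *: u n) 0.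
Proof.
move=> c0 uc /weakly_cvgP u0; apply/weakly_cvgP => f e e0.
have ec0 : 0 < e * c by rewrite mulr_gt0.
apply: filterS (u0 f _ ec0) => n; rewrite !subr0 evZ normrM => h.
have un0 : 0 < `|u n| by apply: lt_le_trans (uc n).
rewrite ger0_norm ?invr_ge0 // mulrC ltr_pdivrMr //.
by apply: lt_le_trans h _; apply: ler_wpM2l => //; exact: ltW.
Qed.

(** A norm limit of points of [C] agrees with one of their weak cluster points
    in [C] on every functional. *)
Lemma weakly_compact_closed C : weakly_compact C -> closed C.
Proof.
move=> Ccpt; apply: closed_cvg_seq => u l Cu /cvg_weakly/weakly_cvgP ul.
have [m Cm um] := weakly_compact_cluster _ _ Ccpt Cu.
suff -> : l = m by [].
apply: ev_inj => f; apply/eqP; rewrite -subr_eq0 -normr_le0.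
apply/ler_addgt0Pr => e e0; have e20 : 0 < e / 2 by rewrite divr_gt0.
have [N _ Nu] := ul f _ e20.
have [n Nn /(_ 0%N isT) mn] := um (fun=> f) 1%N _ N e20.
have := Nu n Nn; move: mn => /=.
by rewrite !evB !ltr_norml ler_norml => /andP[? ?] /andP[? ?]; lra.
Qed.
End WeakTopology.

(** * Weakly compact sets: boundedness and sequential compactness *)
Section WeaklyCompact.
Context {R : realType} {X : normedModType R}.
Implicit Types (e r : R) (f : dual X) (C F : set X) (u v : nat -> X) (l x y : X).

Section GlidingHump.
Variables (g : nat -> dual X) (c : nat -> X).
Hypothesis g_le : forall n x, `|ev (g n) x| <= `|x|.
Hypothesis g_c : forall n, ev (g n) (c n) = `|c n|.

(** Partial sums of [sum_m (+-) 3^-m g m]. The sign of the m-th term is chosen so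
    that the new value at [c m] is at least as large as the term added; the
    later terms are too small to cancel it. *)
Fixpoint hump n : X -> R :=
  if n is m.+1 then fun x => hump m x +
    (if 3^-1 ^+ m * `|c m| <= `|hump m (c m) + 3^-1 ^+ m * `|c m| | then 1 else -1)
      * (3^-1 ^+ m * ev (g m) x)
  else fun=> 0.

Lemma hump_linear n k x y : hump n (k *: x + y) = k * hump n x + hump n y.
Proof.
elim: n => [|n IH] /=; first by rewrite mulr0 addr0.
by rewrite IH evD evZ; ring.
Qed.

Lemma hump_large n : 3^-1 ^+ n * `|c n| <= `|hump n.+1 (c n)|.
Proof.
rewrite /= g_c; set b := _ * `|c n|; set h := hump n (c n).
have b0 : 0 <= b by rewrite mulr_ge0 // exprn_ge0.
case: ifPn => [|]; first by rewrite mul1r.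
rewrite -ltNge mulN1r ltr_norml => /andP[h1 h2].
by rewrite ler0_norm; lra.
Qed.

Lemma hump_cauchy n m x : (n <= m)%N ->
  `|hump m x - hump n x| <= 3 / 2 * (3^-1 ^+ n - 3^-1 ^+ m) * `|x|.
Proof.
move=> nm; rewrite -(subnKC nm); elim: (m - n)%N => [|k IH].
  by rewrite addn0 !subrr normr0 mulr0 mul0r.
rewrite addnS /=; set q := 3^-1 ^+ (n + k); rewrite exprS -/q.
set s := (if _ then _ else _).
have s1 : `|s| = 1 by rewrite /s; case: ifP => _; rewrite ?normrN normr1.
have q0 : 0 <= q by rewrite exprn_ge0.
have := g_le (n + k) x; move: IH; rewrite -/q.
rewrite addrAC; move=> IH gx; apply: le_trans (ler_normD _ _) _.
rewrite !normrM s1 mul1r (ger0_norm q0).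
have := ler_wpM2l q0 gx; lra.
Qed.

(** The limit of the functionals [hump n]. Its value at [x] is obtained as an
    infimum: by [hump_cauchy], [hump n x] increased by the bound on the remaining
    terms decreases to the limit. *)
Lemma gliding_hump :
  exists f, forall n, 3^-1 ^+ n * `|c n| <= 2 * `|ev f (c n)|.
Proof.
pose E x := [set hump n x + 3 / 2 * 3^-1 ^+ n * `|x| | n in [set: nat]].
have q0 n : 0 <= 3^-1 ^+ n :> R by rewrite exprn_ge0.
have Elb x n : lbound (E x) (hump n x - 3 / 2 * 3^-1 ^+ n * `|x|).
  move=> _ [m _ <-]; have x0 := normr_ge0 x.
  have hn := mulr_ge0 (q0 n) x0; have hm := mulr_ge0 (q0 m) x0.
  have [nm|/ltnW mn] := leqP n m.
  - by have := hump_cauchy _ _ x nm; rewrite ler_norml => /andP[? ?]; lra.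
  - by have := hump_cauchy _ _ x mn; rewrite ler_norml => /andP[? ?]; lra.
have E0 x : E x !=set0 by eexists; exists 0%N.
pose f x : R := inf (E x).
have f_hump x n : `|f x - hump n x| <= 3 / 2 * 3^-1 ^+ n * `|x|.
  rewrite ler_norml; apply/andP; split.
    have : hump n x - 3 / 2 * 3^-1 ^+ n * `|x| <= f x by apply: lb_le_inf.
    lra.
  have : f x <= hump n x + 3 / 2 * 3^-1 ^+ n * `|x|.
    by apply: ge_inf; [exists (hump 0 x - 3 / 2 * 3^-1 ^+ 0 * `|x|)|exists n].
  lra.
have flin : linear (f : X -> R^o).
  move=> k x y; apply/eqP; rewrite -subr_eq0 -normr_le0.
  set z := k *: x + y.
  have K0 : 0 <= 3 / 2 * (`|z| + `|k| * `|x| + `|y|).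
    by rewrite mulr_ge0 // !addr_ge0 // mulr_ge0.
  have h n : `|f z - (k * f x + f y)| <=
             3 / 2 * (`|z| + `|k| * `|x| + `|y|) * 3^-1 ^+ n.
    have -> : f z - (k * f x + f y) =
      (f z - hump n z) + (k * (hump n x - f x) + (hump n y - f y)).
      by rewrite hump_linear; ring.
    apply: le_trans (ler_normD _ _) _.
    have := f_hump z n.
    have : `|k * (hump n x - f x) + (hump n y - f y)| <=
        `|k| * (3 / 2 * 3^-1 ^+ n * `|x|) + 3 / 2 * 3^-1 ^+ n * `|y|.
      apply: le_trans (ler_normD _ _) _; apply: lerD.
        by rewrite normrM ler_wpM2l // distrC.
      by rewrite distrC.
    lra.
  apply/ler_addgt0Pr => e e0; rewrite add0r.
  have [n hn] : exists n, 3 / 2 * (`|z| + `|k| * `|x| + `|y|) * 3^-1 ^+ n < e.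
    set K := 3 / 2 * _ in K0 *.
    have K1 : 0 < e / (K + 1) by rewrite divr_gt0 // ltr_wpDl.
    have /cvgrPdist_lt/(_ _ K1)/filter_ex[n] :
        (fun n => 3^-1 ^+ n : R^o) @ \oo --> (0 : R^o).
      by apply: cvg_expr; rewrite ger0_norm ?invf_lt1 ?ltr1n.
    rewrite sub0r normrN ger0_norm // ltr_pdivlMr ?ltr_wpDl // => hn.
    by exists n; have := q0 n; lra.
  exact: le_trans (h n) (ltW hn).
pose F : {linear X -> R^o} :=
  HB.pack (f : X -> R^o) (GRing.isLinear.Build _ _ _ _ (f : X -> R^o) flin).
have [|f' f'E] := dual_of_bounded F (3 / 2).
  by move=> x; have := f_hump x 0%N; rewrite /= subr0 expr0 mulr1.
exists f' => n; rewrite f'E /=.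
have := f_hump (c n) n.+1; rewrite exprS; set q := 3^-1 ^+ n => h1.
have := hump_large n; rewrite -/q => h2.
have : `|hump n.+1 (c n)| <= `|f (c n)| + `|f (c n) - hump n.+1 (c n)|.
  by rewrite [X in _ <= _ + X]distrC -{1}(subrKC (f (c n)) (hump _ _)) ler_normD.
lra.
Qed.
End GlidingHump.

(** If [C] contained vectors [c n] of norm larger than [2 n 3^n], the functional
    of [gliding_hump] would be unbounded on each of their subsequences, although
    it is bounded near a weak cluster point. *)
Lemma weakly_compact_bounded C :
  weakly_compact C -> exists M, forall x, C x -> `|x| <= M.
Proof.
move=> Ccpt; apply: contrapT => Cunb.
have h n : exists x, C x /\ 2 * n%:R * 3 ^+ n < `|x|.
  apply: contrapT => nx; apply: Cunb; exists (2 * n%:R * 3 ^+ n) => x Cx.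
  by rewrite leNgt; apply/negP => xn; apply: nx; exists x.
have [c cP] := choice h.
have hg n : exists f, (forall y, `|ev f y| <= `|y|) /\ ev f (c n) = `|c n|.
  by have [f] := norming (c n); exists f.
have [g gP] := choice hg.
have [f fc] := gliding_hump g c (fun n => (gP n).1) (fun n => (gP n).2).
have fbig n : n%:R <= `|ev f (c n)|.
  have := fc n; have := (cP n).2.
  have q0 : 0 < 3^-1 ^+ n :> R by rewrite exprn_gt0.
  rewrite -(ltr_pM2l q0) mulrCA -exprMn mulVf // expr1n mulr1; lra.
have [l Cl lc] := weakly_compact_cluster C c Ccpt (fun n => (cP n).1).
have [N N1] : exists N, 1 + `|ev f l| < N%:R.
  exists (Num.bound (1 + `|ev f l|)).
  by apply: le_lt_trans (archi_boundP _) => //; rewrite addr_ge0.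
have [n Nn /(_ 0%N isT) /=] := lc (fun=> f) 1%N 1 N ltr01.
rewrite evB => h1; have := fbig n.
have : `|ev f (c n)| <= `|ev f (c n) - ev f l| + `|ev f l|.
  by rewrite -{1}(subrK (ev f l) (ev f (c n))) ler_normD.
have : (N%:R : R) <= n%:R by rewrite ler_nat.
lra.
Qed.

(** The coefficients lie in [K], mapped to the scalars by [i], so that rational
    combinations, of which there are countably many, are treated together with
    the real ones. *)
Definition lincomb (K : nmodType) (i : K -> R) u (s : seq (nat * K)) : X :=
  \sum_(p <- s) i p.2 *: u p.1.

Lemma lincomb_rat_dense u (s : seq (nat * R)) e : 0 < e ->
  exists s' : seq (nat * rat),
    `|lincomb R id u s - lincomb rat (@ratr R) u s'| < e.
Proof.
elim: s e => [|[n a] s IH] e e0.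
  by exists [::]; rewrite /lincomb !big_nil subrr normr0.
have e20 : 0 < e / 2 by rewrite divr_gt0.
have [s' ss'] := IH _ e20.
have un0 : 0 < `|u n| + 1 by rewrite ltr_wpDl.
have d0 : 0 < e / 2 / (`|u n| + 1) by rewrite divr_gt0.
have [b] := @rat_in_itvoo R (a - e / 2 / (`|u n| + 1))
  (a + e / 2 / (`|u n| + 1)) ltac:(lra).
rewrite in_itv /= => /andP[b1 b2].
exists ((n, b) :: s'); rewrite /lincomb !big_cons /= opprD addrACA -scalerBl.
apply: le_lt_trans (ler_normD _ _) _; rewrite normrZ.
have ab : `|a - ratr b| * (`|u n| + 1) < e / 2.
  by rewrite -ltr_pdivlMr // ltr_norml; apply/andP; split; lra.
move: ss'; rewrite /lincomb => ss'.
have := normr_ge0 (a - ratr b); lra.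
Qed.

Definition closed_span u : set X :=
  [set x | forall e, 0 < e -> exists s, `|x - lincomb R id u s| < e].

Lemma closed_span_lin u (a b : R) x y :
  closed_span u x -> closed_span u y -> closed_span u (a *: x + b *: y).
Proof.
move=> ux uy e e0.
have K0 : 0 < `|a| + `|b| + 1 by rewrite ltr_wpDl // addr_ge0.
have d0 : 0 < e / (`|a| + `|b| + 1) by rewrite divr_gt0.
have [s xs] := ux _ d0; have [t yt] := uy _ d0.
exists ([seq (p.1, a * p.2) | p <- s] ++ [seq (p.1, b * p.2) | p <- t]).
have sc k q : lincomb R id u [seq (p.1, k * p.2) | p <- q] = k *: lincomb R id u q.
  rewrite /lincomb big_map scaler_sumr; apply: eq_bigr => p _ /=.
  by rewrite scalerA.
have -> : lincomb R id u ([seq (p.1, a * p.2) | p <- s] ++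
      [seq (p.1, b * p.2) | p <- t]) =
    a *: lincomb R id u s + b *: lincomb R id u t.
  by rewrite -!sc /lincomb big_cat.
rewrite opprD addrACA -!scalerBr; apply: le_lt_trans (ler_normD _ _) _.
rewrite !normrZ; set d := e / _ in d0 xs yt.
have h1 : `|a| * `|x - lincomb R id u s| <= `|a| * d by rewrite ler_wpM2l // ltW.
have h2 : `|b| * `|y - lincomb R id u t| <= `|b| * d by rewrite ler_wpM2l // ltW.
have : e = d * (`|a| + `|b| + 1) by rewrite /d divfK // gt_eqF.
lra.
Qed.

Lemma closed_span_convex u : convex_subset (closed_span u).
Proof. by move=> a x y _; exact: closed_span_lin. Qed.

Lemma closed_closed_span u : closed (closed_span u).
Proof.
apply: closed_cvg_seq => v l uv vl e e0.
have e20 : 0 < e / 2 by rewrite divr_gt0.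
move/cvg_normP: vl => /(_ _ e20)/filter_ex[n ln].
have [s vs] := uv n _ e20; exists s.
have -> : l - lincomb R id u s = (l - v n) + (v n - lincomb R id u s).
  by rewrite addrA subrK.
by apply: le_lt_trans (ler_normD _ _) _; rewrite distrC in ln; lra.
Qed.

Lemma closed_span_mem u n : closed_span u (u n).
Proof.
move=> e e0; exists [:: (n, 1)].
by rewrite /lincomb big_seq1 /= scale1r subrr normr0.
Qed.

Lemma closed_span_dense u x e : closed_span u x -> 0 < e ->
  exists s, `|x - lincomb rat (@ratr R) u s| < e.
Proof.
move=> ux e0; have e20 : 0 < e / 2 by rewrite divr_gt0.
have [s xs] := ux _ e20; have [t st] := lincomb_rat_dense u s _ e20.
exists t.
rewrite -(subrK (lincomb R id u s) x) -addrA.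
by apply: le_lt_trans (ler_normD _ _) _; lra.
Qed.

(** The Eberlein-Smulian theorem. The closed span of the sequence is separable,
    so countably many functionals separate its points. A subsequence on which
    these functionals converge to their values at one cluster point has no other
    cluster point. *)
Lemma weakly_compact_sequential C u : weakly_compact C -> (forall n, C (u n)) ->
  exists phi : nat -> nat, (forall n, (n <= phi n)%N) /\
    exists2 l, C l & weakly_cvg_to (u \o phi) l.
Proof.
move=> Ccpt Cu.
pose D j := if unpickle j is Some s then lincomb rat (@ratr R) u s else 0.
have hg j : exists f, (forall y, `|ev f y| <= `|y|) /\ ev f (D j) = `|D j|.
  by have [f] := norming (D j); exists f.
have [g gP] := choice hg.
have g_sep x : closed_span u x -> (forall j, ev (g j) x = 0) -> x = 0.
  move=> ux gx; apply/eqP; rewrite -normr_le0 leNgt; apply/negP => x0.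
  have x40 : 0 < `|x| / 4 by rewrite divr_gt0.
  have [s xs] := closed_span_dense _ _ _ ux x40.
  have := gP (pickle s); rewrite /D pickleK => -[g1 gs].
  have := g1 (x - lincomb rat (@ratr R) u s).
  rewrite evB gx gs sub0r normrN normr_id.
  have := ler_normD (x - lincomb rat (@ratr R) u s) (lincomb rat (@ratr R) u s).
  rewrite subrK; lra.
have cluster_span v l : (forall n, closed_span u (v n)) ->
    (forall (g : nat -> dual X) k (e : R) N, 0 < e -> exists2 n, (N <= n)%N &
       forall j, (j < k)%N -> `|ev (g j) (v n - l)| < e) -> closed_span u l.
  move=> uv vl; apply: contrapT => nul.
  have [|f [e e0 fe]] := separation _ l (closed_span_convex u) _
    (closed_closed_span u) nul; first by exists (v 0%N).
  have [n _ /(_ 0%N isT)] := vl (fun=> f) 1%N e 0%N e0.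
  by have := fe _ (uv n); rewrite evB ltr_norml => ? /andP[]; lra.
have [l Cl ul] := weakly_compact_cluster C u Ccpt Cu.
have hphi k : exists n, (k <= n)%N /\
    forall j, (j < k)%N -> `|ev (g j) (u n - l)| < k.+1%:R^-1.
  have [|n kn un] := ul g k k.+1%:R^-1 k; first by rewrite invr_gt0.
  by exists n.
have [phi phiP] := choice hphi.
exists phi; split=> [n|]; first exact: (phiP n).1.
exists l => //; apply/weakly_cvgP => f e e0; apply: contrapT => nfe.
have hpsi n : exists k, (n <= k)%N /\ e <= `|ev f (u (phi k) - l)|.
  apply: contrapT => nk; apply: nfe; exists n => // k nk' /=.
  by rewrite ltNge; apply/negP => ek; apply: nk; exists k.
have [psi psiP] := choice hpsi.
have [m Cm vm] := weakly_compact_cluster C (u \o (phi \o psi)) Ccpt (fun n => Cu _).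
have um : closed_span u m by apply: cluster_span vm => n; exact: closed_span_mem.
have {}ul : closed_span u l by apply: cluster_span ul => n; exact: closed_span_mem.
have lm : m = l.
  apply/eqP; rewrite -subr_eq0; apply/eqP/g_sep.
    by have := closed_span_lin u 1 (-1) _ _ um ul; rewrite scale1r scaleN1r.
  move=> j; apply/eqP; rewrite -normr_le0; apply/ler_addgt0Pr => d d0.
  have d20 : 0 < d / 2 by rewrite divr_gt0.
  have [N _ Nd] := near_infty_natSinv_lt (PosNum d20).
  have [n Nn /(_ 0%N isT) vn] := vm (fun=> g j) 1%N _ (maxn N j.+1) d20.
  have [npsi _] := psiP n.
  have jn : (j < psi n)%N.
    by apply: leq_trans npsi; apply: leq_trans Nn; rewrite leq_maxr.
  have Npsi : (N <= psi n)%N.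
    by apply: leq_trans npsi; apply: leq_trans Nn; rewrite leq_maxl.
  pose q : R := (psi n).+1%:R^-1.
  have qd : q < d / 2 by exact: Nd.
  have := (phiP (psi n)).2 j jn; rewrite -/q; move: vn => /=.
  rewrite !evB !ltr_norml ler_norml => /andP[? ?] /andP[? ?].
  by apply/andP; split; lra.
have [n _ /(_ 0%N isT)] := vm (fun=> f) 1%N e 0%N e0.
by rewrite lm ltNge (psiP n).2.
Qed.
End WeaklyCompact.

(** * Asymptotic regularity of averaged maps *)
Section GoebelKirk.
Context {R : realType} {X : normedModType R}.
Variables (c : R) (x t : nat -> X).
Hypothesis c01 : 0 < c < 1.
Hypothesis xS : forall n, x n.+1 = (1 - c) *: x n + c *: t n.
Hypothesis tS : forall n, `|t n.+1 - t n| <= `|x n.+1 - x n|.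

Let a n := `|t n - x n|.

Let c0 : 0 < c. Proof. by case/andP: c01. Qed.
Let c1 : 0 < 1 - c. Proof. by rewrite subr_gt0; case/andP: c01. Qed.

Lemma gk_step n : `|x n.+1 - x n| = c * a n.
Proof.
have -> : x n.+1 - x n = c *: (t n - x n).
  rewrite xS scalerBl scale1r scalerBr addrAC [x n - _ - _]addrAC subrr.
  by rewrite add0r addrC.
by rewrite normrZ gtr0_norm.
Qed.

Lemma gk_nonincr n : a n.+1 <= a n.
Proof.
have -> : a n.+1 = `|(t n.+1 - t n) + (1 - c) *: (t n - x n)|.
  rewrite /a xS; congr `|_|.
  have -> : (1 - c) *: (t n - x n) = t n - ((1 - c) *: x n + c *: t n).
    by rewrite scalerBr [(1 - c) *: t n]scalerBl scale1r opprD addrA addrAC.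
  by rewrite [RHS]addrA subrK.
apply: le_trans (ler_normD _ _) _; rewrite normrZ (gtr0_norm c1).
by have := tS n; rewrite gk_step -/(a n); lra.
Qed.

Lemma gk_nonincrD n k : a (n + k) <= a n.
Proof.
elim: k => [|k IH]; first by rewrite addn0.
by rewrite addnS; exact: le_trans (gk_nonincr _) IH.
Qed.

Lemma gk_t_dist i n : `|t (i + n) - t i| <= n%:R * (c * a i).
Proof.
elim: n => [|n IH]; first by rewrite addn0 subrr normr0 mul0r.
rewrite addnS -(subrK (t (i + n)) (t _)) -addrA.
apply: le_trans (ler_normD _ _) _.
have := tS (i + n); rewrite gk_step.
have := ler_wpM2l (ltW c0) (gk_nonincrD i n).
rewrite -natr1; lra.
Qed.

Lemma gk_bernoulli n : (1 - c) ^+ n * (1 + n%:R * c) <= 1.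
Proof.
elim: n => [|n IH]; first by rewrite expr0 mul0r addr0 mulr1.
apply: le_trans IH; rewrite exprS -natr1.
have q0 : 0 <= (1 - c) ^+ n by rewrite exprn_ge0 // ltW.
have -> : (1 - c) * (1 - c) ^+ n * (1 + (n%:R + 1) * c) =
  (1 - c) ^+ n * ((1 - c) * (1 + (n%:R + 1) * c)) by ring.
apply: ler_wpM2l => //.
have : 0 <= (n%:R + 1) * (c * c) by rewrite mulr_ge0 // ?mulr_ge0 // ltW.
lra.
Qed.

(** The inequality of Goebel and Kirk, by induction on [n] for all [i] at once:
    if the displacement barely decreases from [i] to [i + n], then [t (i + n)] is
    at least about [(1 + n c) a i] away from [x i]. *)
Lemma goebel_kirk i n : (1 - c) ^+ n * (1 + n%:R * c) * a i <=
  (1 - c) ^+ n * `|t (i + n) - x i| + (a i - a (i + n)).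
Proof.
elim: n i => [|n IH] i; first by rewrite addn0 expr0 mul0r addr0 subrr addr0 !mul1r.
have := IH i.+1; rewrite addSnnS => {}IH.
set e := (i + n.+1)%N in IH *; set q := (1 - c) ^+ n in IH *.
have q0 : 0 <= q by rewrite exprn_ge0 // ltW.
have D : `|t e - x i.+1| <= (1 - c) * `|t e - x i| + c * ((n.+1)%:R * (c * a i)).
  have -> : t e - x i.+1 = (1 - c) *: (t e - x i) + c *: (t e - t i).
    by rewrite xS !scalerBr addrACA -scalerDl [1 - c + c]addrC subrKC scale1r opprD.
  apply: le_trans (ler_normD _ _) _; rewrite !normrZ (gtr0_norm c0) (gtr0_norm c1).
  rewrite lerD2l; apply: ler_wpM2l; first exact: ltW.
  exact: gk_t_dist.
have h1 := ler_wpM2l q0 D.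
have h2 : (1 - q * (1 + n%:R * c)) * a i.+1 <= (1 - q * (1 + n%:R * c)) * a i.
  by apply: ler_wpM2l; [rewrite subr_ge0; exact: gk_bernoulli|exact: gk_nonincr].
rewrite exprS -/q -natr1; rewrite -natr1 in h1.
have : (1 - q * (1 + n%:R * c)) * a i + q * (c * ((n%:R + 1) * (c * a i))) =
  a i - (1 - c) * q * (1 + (n%:R + 1) * c) * a i by ring.
lra.
Qed.

(** Over a block of [m] steps, with [m c e >= d], a displacement that stays above
    [e] loses a definite amount, since [|t j - x i|] is at most [d]. *)
Lemma gk_drop (d e : R) m k : (forall i j, `|t j - x i| <= d) -> 0 < e ->
  d <= m%:R * c * e ->
  a (k * m) <= e \/ a (k * m) <= d - k%:R * ((1 - c) ^+ m * e).
Proof.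
move=> td e0 dm; elim: k => [|k IH].
  by right; rewrite mul0n mul0r subr0; exact: td.
have [|ae] := leP (a (k.+1 * m)) e; first by left.
have sk : (k.+1 * m = k * m + m)%N by rewrite mulSn addnC.
have ak : e < a (k * m) by apply: lt_le_trans ae _; rewrite sk; exact: gk_nonincrD.
right; case: IH => [|IH]; first by rewrite leNgt ak.
have := goebel_kirk (k * m) m; rewrite -sk.
set q := (1 - c) ^+ m in IH *.
have q0 : 0 <= q by rewrite exprn_ge0 // ltW.
have h1 := ler_wpM2l q0 (td (k * m)%N (k.+1 * m)%N).
have mc : 0 <= m%:R * c by rewrite mulr_ge0 // ltW.
have h2 : q * ((1 + m%:R * c) * e) <= q * ((1 + m%:R * c) * a (k * m)).
  by apply: ler_wpM2l => //; apply: ler_wpM2l; [exact: addr_ge0|exact: ltW].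
have h3 := ler_wpM2l q0 dm.
rewrite -natr1; lra.
Qed.
End GoebelKirk.

Section ConditionC.
Context {R : realType} {X : normedModType R}.
Variables (c : R) (K : set X) (T : X -> X).
Hypothesis c01 : 0 < c < 1.
Hypothesis Kconv : convex_subset K.
Hypothesis KT : forall x, K x -> K (T x).
Hypothesis TC : condition_C_ c K T.

(** The weight is the constant of the condition on [T], so that [x] and
    [averaged x] always satisfy its premise (with equality). *)
Definition averaged (x : X) : X := (1 - c) *: x + c *: T x.

Lemma averaged_in x : K x -> K (averaged x).
Proof.
move=> Kx; rewrite /averaged.
have -> : (1 - c) *: x + c *: T x = c *: T x + (1 - c) *: x by rewrite addrC.
by apply: Kconv => //; [case/andP: c01 => /ltW -> /ltW|exact: KT].
Qed.

Lemma iter_averaged_in n x : K x -> K (iter n averaged x).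
Proof. by move=> Kx; elim: n => //= n IH; exact: averaged_in. Qed.

Lemma averaged_dist x : `|x - averaged x| = c * `|x - T x|.
Proof.
have -> : x - averaged x = c *: (x - T x).
  rewrite /averaged scalerBl scale1r scalerBr opprD addrA opprB addrCA subrr.
  by rewrite addr0.
by rewrite normrZ gtr0_norm //; case/andP: c01.
Qed.

Lemma averaged_step x : K x -> `|T (averaged x) - T x| <= `|averaged x - x|.
Proof.
move=> Kx; rewrite distrC [leRHS]distrC.
by apply: TC => //; [exact: averaged_in|rewrite averaged_dist].
Qed.

Lemma iter_averaged_displacement n x : K x ->
  `|iter n averaged x - T (iter n averaged x)| <= `|x - T x|.
Proof.
move=> Kx.
have h := @gk_nonincrD R X c (fun n => iter n averaged x)
  (fun n => T (iter n averaged x)) c01 (fun=> erefl) _ 0 n.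
rewrite distrC (distrC x); apply: h => m.
exact: averaged_step (iter_averaged_in _ _ Kx).
Qed.

(** The number of iterations depends only on [c], [d] and [e]: [k] blocks of [m]
    steps would make the displacement negative. *)
Lemma uniform_asymptotic_regularity (d e : R) :
  (forall x y, K x -> K y -> `|x - y| <= d) -> 0 < e ->
  exists N, forall x, K x ->
    `|iter N averaged x - T (iter N averaged x)| <= e.
Proof.
move=> Kd e0; case/andP: (c01) => c0 c1.
have ce : 0 < c * e by rewrite mulr_gt0.
pose m := Num.bound (`|d| / (c * e)).
have dm : d <= m%:R * c * e.
  rewrite -mulrA -ler_pdivrMr //.
  have : `|d| / (c * e) < m%:R by apply: archi_boundP; rewrite divr_ge0 // ltW.
  have : d / (c * e) <= `|d| / (c * e).
    by rewrite ler_wpM2r ?ler_norm // invr_ge0 ltW.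
  lra.
have q0 : 0 < (1 - c) ^+ m * e by rewrite mulr_gt0 // exprn_gt0 // subr_gt0.
pose k := Num.bound (`|d| / ((1 - c) ^+ m * e)).
have dk : d <= k%:R * ((1 - c) ^+ m * e).
  rewrite -ler_pdivrMr //.
  have : `|d| / ((1 - c) ^+ m * e) < k%:R.
    by apply: archi_boundP; rewrite divr_ge0 // ltW.
  have : d / ((1 - c) ^+ m * e) <= `|d| / ((1 - c) ^+ m * e).
    by rewrite ler_wpM2r ?ler_norm // invr_ge0 ltW.
  lra.
exists (k * m)%N => x Kx; rewrite distrC.
have [|||h] := @gk_drop R X c (fun n => iter n averaged x)
  (fun n => T (iter n averaged x)) c01 (fun=> erefl) _ d e m k _ e0 dm.
- by move=> n; exact: averaged_step (iter_averaged_in _ _ Kx).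
- by move=> i j; apply: Kd; [apply: KT|]; exact: iter_averaged_in.
- by [].
- by apply: le_trans h _; lra.
Qed.
End ConditionC.

(** * Minimal invariant sets and approximate fixed points *)
Section MinimalSets.
Context {R : realType} {X : normedModType R}.
Implicit Types (e r s d : R) (C D K : set X) (T : X -> X) (x y : X).

Definition invariant_subset C T D : Prop :=
  [/\ D `<=` C, D !=set0, closed D, convex_subset D & forall x, D x -> D (T x)].

(** Zorn's lemma for increasing unions is applied to complements in [C], so that
    the empty chain yields [C] itself. *)
Lemma minimal_invariant_subset C T : weakly_compact C -> invariant_subset C T C ->
  exists2 K, invariant_subset C T K &
    forall D, D `<=` K -> invariant_subset C T D -> D = K.
Proof.
move=> Ccpt CT.
have [F FP Ftot|A [PA Amax]] :=
    @Zorn_bigcup X [set A | invariant_subset C T (C `&` ~` A)].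
  have [[A0 FA0]|F0] := pselect (F !=set0); last first.
    suff -> : (\bigcup_(A in F) A) = set0 by rewrite /= setC0 setIT.
    by apply: bigcup0 => A FA; exfalso; apply: F0; exists A.
  pose G := [set C `&` ~` A | A in F].
  rewrite /=; have -> : C `&` ~` (\bigcup_(A in F) A) = \bigcap_(D in G) D.
    apply/seteqP; split=> [x [Cx Fx] _ [A FA <-]|x Gx].
      by split=> // Ax; apply: Fx; exists A.
    split; first by have [] := Gx _ (ex_intro2 _ _ A0 FA0 erefl).
    by move=> [A FA Ax]; have [_] := Gx _ (ex_intro2 _ _ A FA erefl); apply.
  have GP D : G D -> invariant_subset C T D by move=> [A FA <-]; exact: FP.
  have G0 : G !=set0 by exists (C `&` ~` A0), A0.
  split.
  - by move=> x /(_ _ (ex_intro2 _ _ A0 FA0 erefl))[].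
  - apply: (weakly_compact_chain _ _ Ccpt G0) => [_ _ [A FA <-] [B FB <-]|D /GP[]//].
    have [AB|BA] := Ftot _ _ FA FB; [right|left].
    + by apply: setIS; exact: subsetC.
    + by apply: setIS; exact: subsetC.
  - by apply: closed_bigI => D /GP[].
  - move=> a x y a01 Gx Gy D GD; have [_ _ _ Dc _] := GP D GD.
    by apply: Dc => //; [exact: Gx|exact: Gy].
  - by move=> x Gx D GD; have [_ _ _ _ DT] := GP D GD; apply: DT; exact: Gx.
exists (C `&` ~` A) => // D DK PD; apply/seteqP; split=> // x Kx.
apply: contrapT => nDx; apply: (Amax (~` D)).
  split=> [y Ay /DK[]//|/(_ x nDx)]; by case: Kx.
by rewrite /= setCK; have -> : C `&` D = D by apply/setIidr; case: PD.
Qed.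

(** Closedness at 0 of the displacement map [x |-> x - T x]. *)
Definition displacement_closed C T : Prop := forall y, C y ->
  (forall e, 0 < e -> exists u, [/\ C u, `|u - y| < e & `|u - T u| < e]) -> T y = y.

Lemma within_continuous_displacement_closed C T :
  {within C, continuous T} -> displacement_closed C T.
Proof.
move=> Tc y Cy yu; apply/eqP; rewrite -subr_eq0 -normr_le0.
apply/ler_addgt0Pr => e e0; rewrite add0r.
have e30 : 0 < e / 3 by rewrite divr_gt0.
have /cvgrPdist_lt/(_ _ e30)/nbhs_ballP[d /= d0 dT] :=
  (subspace_continuousP _ _).1 Tc y Cy.
have [|u [Cu uy uT]] := yu (Num.min (e / 3) d); first by rewrite lt_min e30.
move: uy uT; rewrite !lt_min => /andP[uy1 uy2] /andP[uT _].
have Tuy : `|T y - T u| < e / 3.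
  by apply: dT Cu; rewrite -ball_normE /= distrC.
have -> : T y - y = (T y - T u) + ((T u - u) + (u - y)).
  by rewrite [T u - u + _]addrA !subrK addrA subrK.
apply: le_trans (ler_normD _ _) _.
have := ler_normD (T u - u) (u - y); rewrite distrC in uT; lra.
Qed.

(** Suzuki's inequality: [T] may be compared with [y] either at [u] or at
    [T u]. *)
Lemma condition_C_dist C T u y : (forall x, C x -> C (T x)) -> condition_C C T ->
  C u -> C y -> `|u - T y| <= 3 * `|u - T u| + `|u - y|.
Proof.
move=> CT TC Cu Cy.
have CTu := CT _ Cu.
have d2 : `|T u - T (T u)| <= `|u - T u|.
  by apply: TC => //; have := normr_ge0 (u - T u); lra.
have D := ler_distD (T u) u (T y).
have D2 := ler_distD (T (T u)) (T u) (T y).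
have D3 := ler_distD u (T u) y.
have D4 := ler_distD y u (T u).
rewrite (distrC y) in D4; rewrite (distrC (T u) u) in D3.
have u0 := normr_ge0 (u - T u).
have [h|h] := leP (2^-1 * `|u - T u|) `|u - y|.
  by have := TC u y Cu Cy h; lra.
have [k|k] := leP (2^-1 * `|T u - T (T u)|) `|T u - y|.
  by have := TC (T u) y CTu Cy k; lra.
lra.
Qed.

Lemma condition_C_displacement_closed C T : (forall x, C x -> C (T x)) ->
  condition_C C T -> displacement_closed C T.
Proof.
move=> CT TC y Cy yu; apply/eqP; rewrite -subr_eq0 -normr_le0.
apply/ler_addgt0Pr => e e0; rewrite add0r.
have e50 : 0 < e / 5 by rewrite divr_gt0.
have [u [Cu uy uT]] := yu _ e50.
have := condition_C_dist C T u y CT TC Cu Cy.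
have := ler_distD u (T y) y; rewrite (distrC (T y) u); lra.
Qed.

Section GoebelKarlovitz.
Variables (c d : R) (K : set X) (T : X -> X).
Hypothesis c01 : 0 < c < 1.
Hypothesis KK : invariant_subset K T K.
Hypothesis Kmin : forall D, D `<=` K -> invariant_subset K T D -> D = K.
Hypothesis Kd : forall x y, K x -> K y -> `|x - y| <= d.
Hypothesis TC : condition_C_ c K T.
Hypothesis Tcl : displacement_closed K T.

Let K0 : K !=set0. Proof. by case: KK. Qed.
Let Kcl : closed K. Proof. by case: KK. Qed.
Let Kconv : convex_subset K. Proof. by case: KK. Qed.
Let KT x : K x -> K (T x). Proof. by case: KK => _ _ _ _; apply. Qed.

Definition approx_fixed_seq (x : nat -> X) : Prop :=
  (forall n, K (x n)) /\
  forall e, 0 < e -> \forall n \near \oo, `|x n - T (x n)| <= e.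

(** The sublevel set at [s] of [y |-> limsup |x n - y|] in [K]. *)
Definition asymptotic_ball (x : nat -> X) s : set X :=
  [set y | K y /\ (forall e, 0 < e -> \forall n \near \oo, `|x n - y| <= s + e)].

(** Either the condition on [T] applies to [x n] and [y] for all large [n], or
    terms of [x] come arbitrarily close to [y], which is then a fixed point. *)
Lemma asymptotic_ball_invariant (x : nat -> X) s y : approx_fixed_seq x ->
  asymptotic_ball x s y -> asymptotic_ball x s (T y).
Proof.
move=> [Kx xT] [Ky xy].
have [ev|nev] :=
    pselect (\forall n \near \oo, c * `|x n - T (x n)| <= `|x n - y|).
  split=> [|e e0]; first exact: KT.
  have e20 : 0 < e / 2 by rewrite divr_gt0.
  apply: filterS3 ev (xT _ e20) (xy _ e20) => n h h1 h2.
  have := ler_distD (T (x n)) (x n) (T y).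
  have := TC _ _ (Kx n) Ky h; lra.
suff -> : T y = y by [].
apply: Tcl => // e e0.
have e20 : 0 < e / 2 by rewrite divr_gt0.
have [N _ xN] := xT _ e20.
have [n [Nn xn]] : exists n, (N <= n)%N /\ `|x n - y| < c * `|x n - T (x n)|.
  apply: contrapT => nn; apply: nev; exists N => // n Nn /=.
  by rewrite leNgt; apply/negP => xn; apply: nn; exists n.
have /= hn := xN n Nn; exists (x n); split=> //; last by lra.
have : c * `|x n - T (x n)| <= `|x n - T (x n)|.
  by rewrite ler_piMl //; case/andP: c01 => _ /ltW.
lra.
Qed.

Lemma asymptotic_ball_convex (x : nat -> X) s : convex_subset (asymptotic_ball x s).
Proof.
move=> a y z a01 [Ky xy] [Kz xz]; split=> [|e e0]; first exact: Kconv.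
apply: filterS2 (xy e e0) (xz e e0) => n; rewrite !(distrC (x n)).
exact: convex_ball.
Qed.

Lemma asymptotic_ball_closed (x : nat -> X) s : closed (asymptotic_ball x s).
Proof.
apply: closed_cvg_seq => u l Du /cvg_normP ul; split=> [|e e0].
  by apply: (closed_cvg (fun y => K y) _ _ _ ((cvg_normP u l).2 ul)) => //;
     apply: nearW => n; exact: (Du n).1.
have e20 : 0 < e / 2 by rewrite divr_gt0.
have [k kl] := filter_ex (ul _ e20).
apply: filterS ((Du k).2 _ e20) => n h.
by have := ler_distD (u k) (x n) l; lra.
Qed.

(** Minimality of [K], applied to an asymptotic ball. *)
Lemma asymptotic_ball_full (x : nat -> X) s y z : approx_fixed_seq x ->
  asymptotic_ball x s y -> K z -> asymptotic_ball x s z.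
Proof.
move=> ax Dy Kz; suff -> : asymptotic_ball x s = K by [].
apply: Kmin => [? []//|]; split.
- by move=> ? [].
- by exists y.
- exact: asymptotic_ball_closed.
- exact: asymptotic_ball_convex.
- by move=> ?; exact: asymptotic_ball_invariant.
Qed.

(** For a base point [p] of [K], take for [rho] the least [s] such that some
    points of arbitrarily small displacement have distance to [p] at most about
    [s]. Points realizing it form the sequence; by [asymptotic_ball_full], what
    is known at [p] holds at every point of [K]. *)
Lemma minimal_radius : exists2 rho,
  (exists2 x, approx_fixed_seq x & forall y, K y -> asymptotic_ball x rho y) &
  forall y e, K y -> 0 < e -> exists2 r : R, 0 < r &
    forall u, K u -> `|u - T u| <= r -> rho - e <= `|u - y|.
Proof.
have [p Kp] := K0.
pose A := [set s | forall r, 0 < r ->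
  exists u, [/\ K u, `|u - T u| <= r & `|u - p| <= s + r]].
have Ad : A d.
  move=> r r0; have [N hN] := uniform_asymptotic_regularity c K T c01 Kconv
    (@KT) TC d r Kd r0.
  have Ku := iter_averaged_in c K T c01 Kconv (@KT) N p Kp.
  exists (iter N (averaged c T) p); split=> //; first exact: hN.
  by have := Kd _ _ Ku Kp; lra.
have A0 : lbound A 0.
  move=> s As; apply/ler_addgt0Pr => r r0.
  by have [u [_ _ h]] := As r r0; have := normr_ge0 (u - p); lra.
have hA : has_inf A by split; [exists d|exists 0].
pose rho := inf A.
have rhoP n : exists u, [/\ K u, `|u - T u| <= n.+1%:R^-1 &
                             `|u - p| <= rho + n.+1%:R^-1].
  have n0 : (0 : R) < n.+1%:R^-1 by rewrite invr_gt0.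
  have n20 : 0 < n.+1%:R^-1 / 2 :> R by rewrite divr_gt0.
  have [s As srho] := inf_adherent n20 hA.
  have [u [Ku uT up]] := As _ n20.
  move: n0 n20 srho uT up; set q := n.+1%:R^-1; rewrite -/rho => n0 n20 srho uT up.
  by exists u; split=> //; lra.
have [x xP] := choice rhoP.
have small e : 0 < e -> \forall n \near \oo, (n.+1%:R^-1 : R) < e.
  by move=> e0; exact: near_infty_natSinv_lt (PosNum e0).
have ax : approx_fixed_seq x.
  split=> [n|e e0]; first by case: (xP n).
  apply: filterS (small e e0) => n ne.
  by have [_ h _] := xP n; exact: le_trans h (ltW ne).
have xp : asymptotic_ball x rho p.
  split=> // e e0; apply: filterS (small e e0) => n ne.
  by have [_ _ h] := xP n; apply: le_trans h _; rewrite lerD2l ltW.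
exists rho; first by exists x => // y Ky; exact: asymptotic_ball_full ax xp Ky.
move=> y e Ky e0; apply: contrapT => nr.
have hz n : exists u, [/\ K u, `|u - T u| <= n.+1%:R^-1 & `|u - y| < rho - e].
  apply: contrapT => nu; apply: nr; exists n.+1%:R^-1; first by rewrite invr_gt0.
  by move=> u Ku uT; rewrite leNgt; apply/negP => uy; apply: nu; exists u.
have [z zP] := choice hz.
have az : approx_fixed_seq z.
  split=> [n|r r0]; first by case: (zP n).
  apply: filterS (small r r0) => n nr'.
  by have [_ h _] := zP n; exact: le_trans h (ltW nr').
have zy : asymptotic_ball z (rho - e) y.
  split=> // r r0; apply: nearW => n /=; have [_ _ h] := zP n.
  by apply: le_trans (ltW h) _; rewrite lerDl ltW.
have [_ zp] := asymptotic_ball_full z (rho - e) y p az zy Kp.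
have e20 : 0 < e / 2 by rewrite divr_gt0.
have : A (rho - e / 2).
  move=> r r0.
  have [n [h1 h2]] := filter_ex (filterI (az.2 r r0) (zp _ e20)).
  by exists (z n); split=> //; [exact: az.1|lra].
by move/(ge_inf hA.2); rewrite -/rho; lra.
Qed.

(** If [rho <= 0], the sequence converges to every point of [K], in particular to
    [y] and to [T y]. *)
Lemma minimal_radius_gt0 rho (x : nat -> X) : (forall y, K y -> T y <> y) ->
  approx_fixed_seq x -> (forall y, K y -> asymptotic_ball x rho y) -> 0 < rho.
Proof.
move=> nofix ax xy; rewrite ltNge; apply/negP => rho0.
have [y Ky] := K0; apply: (nofix y Ky); apply/eqP; rewrite -subr_eq0 -normr_le0.
apply/ler_addgt0Pr => e e0; rewrite add0r.
have e20 : 0 < e / 2 by rewrite divr_gt0.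
have [n [h1 h2]] := filter_ex
  (filterI ((xy y Ky).2 _ e20) ((xy _ (KT _ Ky)).2 _ e20)).
by have := ler_distD (x n) (T y) y; rewrite (distrC (T y) (x n)); lra.
Qed.
End GoebelKarlovitz.
End MinimalSets.

(** * Sequences close to each other and to a given sequence *)
Section SpreadSequences.
Context {R : realType} {X : normedModType R}.
Implicit Types (e r s : R) (y u v w : X).
Variables (c d rho : R) (K : set X) (T : X -> X) (x : nat -> X).
Hypothesis c01 : 0 < c < 1.
Hypothesis Kconv : convex_subset K.
Hypothesis KT : forall y, K y -> K (T y).
Hypothesis Kd : forall y z, K y -> K z -> `|y - z| <= d.
Hypothesis TC : condition_C_ c K T.
Hypothesis xK : forall n, K (x n).
Hypothesis xT : forall e, 0 < e -> \forall n \near \oo, `|x n - T (x n)| <= e.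
Hypothesis x_le : forall y e, K y -> 0 < e ->
  \forall n \near \oo, `|x n - y| <= rho + e.
Hypothesis x_ge : forall y e, K y -> 0 < e ->
  \forall n \near \oo, rho - e <= `|x n - y|.
Hypothesis rho0 : 0 < rho.

Let F := averaged c T.
Let c0 : 0 < c. Proof. by case/andP: c01. Qed.
Let c1 : 0 < 1 - c. Proof. by rewrite subr_gt0; case/andP: c01. Qed.

Lemma averaged_dist_le u v s : `|u - v| <= s -> `|T u - T v| <= s ->
  `|F u - F v| <= s.
Proof.
move=> uv Tuv; have -> : F u - F v = (1 - c) *: (u - v) + c *: (T u - T v).
  by rewrite /F /averaged !scalerBr opprD addrACA.
apply: le_trans (ler_normD _ _) _; rewrite !normrZ (gtr0_norm c0) (gtr0_norm c1).
have := ler_wpM2l (ltW c0) Tuv; have := ler_wpM2l (ltW c1) uv; lra.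
Qed.

(** When the condition on [T] does not apply, [u] and [v] are closer than their
    displacements, and so [T u] and [T v] are at distance at most [3 r]. *)
Lemma averaged_bound u v r s : K u -> K v -> `|u - T u| <= r -> `|v - T v| <= r ->
  3 * r <= s -> `|u - v| <= s -> `|F u - F v| <= s.
Proof.
move=> Ku Kv ur vr rs uv; apply: averaged_dist_le => //.
have [h|h] := leP (c * `|u - T u|) `|u - v|.
  exact: le_trans (TC u v Ku Kv h) uv.
have cu : c * `|u - T u| <= `|u - T u| by rewrite ler_piMl // -subr_ge0 ltW.
have := ler_distD u (T u) (T v); have := ler_distD v u (T v).
by rewrite (distrC (T u) u); lra.
Qed.

Lemma iter_averaged_bound n u v r s : K u -> K v ->
  `|u - T u| <= r -> `|v - T v| <= r -> 3 * r <= s -> `|u - v| <= s ->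
  `|iter n F u - iter n F v| <= s.
Proof.
move=> Ku Kv ur vr rs uv; elim: n => // n IH; rewrite !iterS.
apply: (averaged_bound _ _ r) => //.
- exact: iter_averaged_in.
- exact: iter_averaged_in.
- exact: le_trans (iter_averaged_displacement c K T c01 Kconv KT TC n u Ku) ur.
- exact: le_trans (iter_averaged_displacement c K T c01 Kconv KT TC n v Kv) vr.
Qed.

Definition spread s : Prop := forall e, 0 < e -> exists z : nat -> X,
  [/\ forall n, K (z n),
      \forall n \near \oo, `|z n - T (z n)| <= e,
      \forall n \near \oo, \forall m \near \oo, `|z n - z m| <= s + e &
      \forall n \near \oo, `|z n - x n| <= rho - s + e].

Lemma spread_rho : spread rho.
Proof.
move=> e e0; exists x; split=> //; first exact: xT.
  apply: nearW => n; apply: filterS (x_le (x n) e (xK n) e0) => m.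
  by rewrite distrC.
by apply: nearW => n; rewrite !subrr normr0 add0r ltW.
Qed.

(** The terms of [iter n F \o y] are at mutual distance at most [s < rho], while
    [x] stays at distance about [rho] from each of them. Hence their distance to
    [x m] is bounded below, and for large [m] the condition on [T] applies to
    [x m]. *)
Lemma iter_averaged_near_x (y : nat -> X) r s b n : s < rho ->
  (forall n, K (y n)) ->
  (\forall n \near \oo, `|y n - T (y n)| <= r) -> 3 * r <= s ->
  (\forall n \near \oo, \forall m \near \oo, `|y n - y m| <= s) ->
  (\forall n \near \oo, `|y n - x n| <= b) ->
  forall e, 0 < e -> \forall m \near \oo, `|iter n F (y m) - x m| <= b + e.
Proof.
move=> srho Ky yr rs ys yb; elim: n => [|n IH] e e0.
  by apply: filterS yb => m /= h; apply: le_trans h _; rewrite lerDl ltW.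
have Ku m : K (iter n F (y m)) by exact: iter_averaged_in.
have e20 : 0 < e / 2 by rewrite divr_gt0.
have g0 : 0 < (rho - s) / 2 by rewrite divr_gt0 // subr_gt0.
have [n0 [n0r n0s]] := filter_ex (filterI yr ys).
have far : \forall m \near \oo, (rho - s) / 2 <= `|x m - iter n F (y m)|.
  apply: filterS3 yr n0s (x_ge _ _ (Ku n0) g0) => m mr ms xm.
  have := iter_averaged_bound n _ _ r s (Ky n0) (Ky m) n0r mr rs ms.
  have := ler_distD (iter n F (y m)) (x m) (iter n F (y n0)).
  by rewrite (distrC (iter n F (y m)) (iter n F (y n0))); lra.
have xe : 0 < Num.min (e / 2) ((rho - s) / 2) by rewrite lt_min e20.
apply: filterS3 far (IH _ e20) (xT _ xe) => m h1 h2; rewrite le_min => /andP[h3 h4].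
have cx : c * `|x m - T (x m)| <= `|x m - T (x m)|.
  by rewrite ler_piMl // -subr_ge0 ltW.
have Tx : `|T (x m) - T (iter n F (y m))| <= `|x m - iter n F (y m)|.
  by apply: TC => //; apply: le_trans h1; exact: le_trans cx h4.
rewrite iterS; set u := iter n F (y m) in h1 h2 Tx *.
have D1 : `|F u - F (x m)| <= `|u - x m|.
  by apply: averaged_dist_le => //; rewrite distrC (distrC u).
have D2 : `|x m - F (x m)| <= `|x m - T (x m)| by rewrite averaged_dist.
by have := ler_distD (F (x m)) (F u) (x m); rewrite (distrC (F (x m))); lra.
Qed.

(** Moving every term by the proportion [h] towards one of them, [w], gives the
    two required bounds. It creates a displacement of at most [3 h s], because
    the terms are far enough from [w] for the condition on [T] to compare the old
    and the new points. As [9 h s <= (1 - h) s], iterating the averaged map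
    preserves the bounds while the displacement becomes small again. *)
Lemma spread_step h s : 0 < h <= 10^-1 -> 0 < s <= rho -> spread s ->
  spread ((1 - h) * s).
Proof.
move=> /andP[h0 h1] /andP[s0 srho] spr e e0.
have hs : 0 < h * s by rewrite mulr_gt0.
pose r := Num.min (e / 3) (h * s / 2).
have r0 : 0 < r by rewrite lt_min !divr_gt0.
have re : r <= e / 3 by rewrite ge_min lexx.
have rh : r <= h * s / 2 by rewrite ge_min lexx orbT.
have [z [Kz zr zz zx]] := spr r r0.
have [n0 wz] := filter_ex zz; set w := z n0 in wz.
have Kw : K w by exact: Kz.
pose y n := h *: w + (1 - h) *: z n.
have Ky n : K (y n) by apply: Kconv => //; lra.
have yz n : `|z n - y n| = h * `|z n - w|.
  have -> : z n - y n = h *: (z n - w).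
    rewrite /y scalerBl scale1r scalerBr opprD opprB addrCA addrC.
    by rewrite [z n + _]addrCA subrr addr0.
  by rewrite normrZ gtr0_norm.
have yy : \forall n \near \oo, \forall m \near \oo,
    `|y n - y m| <= (1 - h) * (s + r).
  apply: filterS zz => n; apply: filterS => m h2.
  have -> : y n - y m = (1 - h) *: (z n - z m).
    by rewrite /y scalerBr opprD addrACA subrr add0r.
  have h3 : 0 <= 1 - h by lra.
  by rewrite normrZ ger0_norm //; exact: ler_wpM2l.
have yx : \forall n \near \oo, `|y n - x n| <= rho - (1 - h) * s + 2 * r.
  apply: filterS2 zx wz => n h2 h3.
  have := ler_distD (z n) (y n) (x n); rewrite (distrC (y n) (z n)) yz.
  have := ler_wpM2l (ltW h0) h3; rewrite (distrC w).
  have : h * r <= r by rewrite ler_piMl ?ltW //; lra.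
  lra.
have yr : \forall n \near \oo, `|y n - T (y n)| <= 3 * (h * s).
  have s40 : 0 < s / 4 by rewrite divr_gt0.
  apply: filterS (filterI (filterI zr zx) (filterI wz (x_ge w _ Kw s40))) => n.
  move=> [[h2 h3] [h4 h5]].
  (* w is a point of K, hence at distance about rho from x n *)
  have s2 : s / 2 <= `|z n - w|.
    have := ler_distD (z n) (x n) w; rewrite (distrC (x n) (z n)) => h6.
    have : h * s <= s / 10.
      by rewrite mulrC; apply: ler_wpM2l h1; exact: ltW.
    lra.
  have zT : `|T (z n) - T (y n)| <= `|z n - y n|.
    apply: TC => //; rewrite yz.
    have cz : c * `|z n - T (z n)| <= `|z n - T (z n)|.
      by rewrite ler_piMl // -subr_ge0 ltW.
    have := ler_wpM2l (ltW h0) s2; lra.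
  have := ler_distD (z n) (y n) (T (y n)).
  have := ler_distD (T (z n)) (z n) (T (y n)).
  move: zT; rewrite (distrC (y n) (z n)) yz.
  have := ler_wpM2l (ltW h0) h4; rewrite (distrC w).
  have : h * r <= r / 10 by rewrite mulrC; apply: ler_wpM2l h1; exact: ltW.
  lra.
have hs10 : h * s <= s / 10 by rewrite mulrC; apply: ler_wpM2l h1; exact: ltW.
have hr : h * r <= r by rewrite ler_piMl ?ltW //; lra.
have hr0 : 0 < h * r by rewrite mulr_gt0.
have rs : 3 * (3 * (h * s)) <= (1 - h) * (s + r) by lra.
have srho' : (1 - h) * (s + r) < rho.
  have := ler_wpM2l (ltW h0) rh; lra.
have e30 : 0 < e / 3 by rewrite divr_gt0.
have [N hN] := uniform_asymptotic_regularity c K T c01 Kconv KT TC d e Kd e0.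
exists (fun n => iter N F (y n)); split.
- by move=> n; exact: iter_averaged_in.
- by apply: nearW => n; exact: hN.
- apply: filterS2 (yr) yy => n nr nm; apply: filterS2 yr nm => m mr nm'.
  have := iter_averaged_bound N _ _ _ _ (Ky n) (Ky m) nr mr rs nm'; lra.
- have := iter_averaged_near_x y _ _ _ N srho' Ky yr rs yy yx _ e30.
  apply: filterS => n; lra.
Qed.

(** Steps of proportion 1/10 lead from [rho] below any positive number, and
    a shorter last step reaches [s] exactly. *)
Lemma spread_all s : 0 < s <= rho -> spread s.
Proof.
move=> /andP[s0 srho].
have q01 : 0 < (9 / 10 : R) < 1 by apply/andP; split; lra.
have key k : forall r, 0 < r <= rho -> (9 / 10) ^+ k * rho <= r -> spread r.
  elim: k => [|k IH] r /andP[r0 rrho].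
    rewrite expr0 mul1r => rhor; have -> : r = rho by apply/eqP; rewrite eq_le rrho.
    exact: spread_rho.
  rewrite exprS -mulrA; set b := (9 / 10) ^+ k * rho in IH *.
  move=> br; have [br'|rb] := leP b r; first by apply: IH => //; rewrite r0.
  have b0 : 0 < b by rewrite mulr_gt0 // exprn_gt0 //; lra.
  have brho : b <= rho.
    by apply: ler_piMl; [exact: ltW|apply: exprn_ile1; lra].
  have -> : r = (1 - (1 - r / b)) * b by rewrite subKr divfK // gt_eqF.
  apply: spread_step; last by apply: IH => //; rewrite b0.
    rewrite subr_gt0 ltr_pdivrMr // mul1r rb /=.
    by rewrite lerBlDr -lerBlDl ler_pdivlMr //; lra.
  by rewrite b0.
have sr0 : 0 < s / rho by rewrite divr_gt0.
have /cvgrPdist_lt/(_ _ sr0)/filter_ex[k] :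
    (fun k => (9 / 10) ^+ k : R^o) @ \oo --> (0 : R^o).
  by apply: cvg_expr; rewrite ger0_norm; lra.
have qk0 : 0 <= (9 / 10) ^+ k :> R by apply: exprn_ge0; lra.
rewrite sub0r normrN ger0_norm //.
rewrite ltr_pdivlMr // => /ltW; apply: key.
by rewrite s0.
Qed.
End SpreadSequences.

(** * Nearly uniformly noncreasy spaces *)
Section Noncreasy.
Context {R : realType} {X : normedModType R}.
Implicit Types (a x l q : X) (e r s t : R).

Lemma b_modulus_ge (y : nat -> X) x e r : unit_sphere X x ->
  weakly_null_sphere_seq X y -> (forall n, r <= `|x + e *: y n|) ->
  ((r - 1)%:E <= b_modulus e x)%E.
Proof.
move=> x1 ynull yr; apply: le_ereal_sup_tmp.
exists (limn_einf (fun n => `|x + e *: y n|%:E) - `|x|%:E)%E; first by exists y.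
rewrite x1 EFinB leeD2r // limn_einf_lim.
apply: lime_ge; first exact: is_cvg_einfs.
apply: nearW => n; apply: le_ereal_inf_tmp => _ [m _ <-].
by rewrite lee_fin.
Qed.

Lemma d_modulus_le (y : nat -> X) x e r : unit_sphere X x ->
  weakly_null_sphere_seq X y -> (forall n, `|x + e *: y n| <= r) ->
  (d_modulus e x <= (r - 1)%:E)%E.
Proof.
move=> x1 ynull yr; apply: ge_ereal_inf.
exists (limn_esup (fun n => `|x + e *: y n|%:E) - `|x|%:E)%E; first by exists y.
rewrite x1 EFinB leeD2r // limn_esup_lim.
apply: lime_le; first exact: is_cvg_esups.
apply: nearW => n; apply: ge_ereal_sup => _ [m _ <-].
by rewrite lee_fin.
Qed.

Lemma normalized_null_seq (u : nat -> X) r : 0 < r ->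
  (forall n, r <= `|u n|) -> weakly_cvg_to u 0 ->
  weakly_null_sphere_seq X (fun n => `|u n|^-1 *: u n).
Proof.
move=> r0 ur u0; split; last exact: weakly_cvg_normalize r0 ur u0.
move=> n; rewrite /unit_sphere /= normrZ normfV normr_id mulVf //.
by rewrite gt_eqF //; exact: lt_le_trans (ur n).
Qed.

(** The heart of the argument, with [s = rho - tau] and [tau = s t]: in the
    direction of [a = l - q], the weakly null vectors [w n] give
    [b t >= 3 t / 4 > t / 2], and the weakly null vectors [v n] give
    [d (1/2) <= t / 2 < t]. *)
Lemma noncreasy_spread_false t s r (x z : nat -> X) q l :
  0 < t -> (forall a, unit_sphere X a ->
    (t%:E <= d_modulus 2^-1 a)%E \/ (b_modulus t a <= (2^-1 * t)%:E)%E) ->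
  0 < s -> 0 < r -> 16 * ((1 + t) * r) <= s * t -> 16 * r <= s ->
  weakly_cvg_to x q -> weakly_cvg_to z l ->
  (\forall n \near \oo, \forall m \near \oo, `|z n - z m| <= s * t + r) ->
  (\forall n \near \oo, `|z n - x n| <= s + r) ->
  (\forall n \near \oo, s * (1 + t) - r <= `|z n - q|) ->
  (\forall n \near \oo, s * (1 + t) - r <= `|x n - q|) -> False.
Proof.
move=> t0 NC s0 r0 rst rs xq zl zz zx zq xq'.
have st0 : 0 < s * t by rewrite mulr_gt0.
have tr0 : 0 < t * r by rewrite mulr_gt0.
pose a := l - q.
have a_le : `|a| <= s + r.
  have := weakly_cvg_norm_le (fun n => z n - x n) a 0 (s + r)
    (weakly_cvgB _ _ _ _ zl xq).
  by rewrite subr0; apply; apply: filterS zx => n; rewrite subr0.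
have zl_le : \forall n \near \oo, `|z n - l| <= s * t + r.
  apply: filterS zz => n h; rewrite distrC.
  by apply: (weakly_cvg_norm_le z) => //; apply: filterS h => m; rewrite distrC.
have [N _ hN] := filterI (filterI zl_le zx) (filterI zq xq').
have [n0 [[h1 _] [h2 _]]] := filter_ex (filterI (filterI zl_le zx) (filterI zq xq')).
have a_ge : s - 2 * r <= `|a|.
  by have := ler_distD l (z n0) q; rewrite -/a; lra.
have a0 : 0 < `|a| by lra.
have NN n : (N <= n + N)%N by rewrite leq_addl.
pose w n := z (n + N)%N - l.
pose v n := w n - (x (n + N)%N - q).
have shift (u : nat -> X) m : weakly_cvg_to u m ->
    weakly_cvg_to (fun n => u (n + N)%N) m.
  by apply: (weakly_cvg_sub u m (fun n => n + N)%N) => n; rewrite leq_addr.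
have w0 : weakly_cvg_to w 0.
  by have := weakly_cvgB _ _ _ _ (shift _ _ zl) (weakly_cvg_cst l); rewrite subrr.
have v0 : weakly_cvg_to v 0.
  have := weakly_cvgB _ _ _ _ (shift _ _ xq) (weakly_cvg_cst q); rewrite subrr.
  by move/(weakly_cvgB _ _ _ _ w0); rewrite subrr.
have w_le n : `|w n| <= s * t + r by have [[]] := hN _ (NN n).
have aw n : s * (1 + t) - r <= `|a + w n|.
  have -> : a + w n = z (n + N)%N - q by rewrite addrC /w /a addrA subrK.
  by have [_ []] := hN _ (NN n).
have w_ge n : s * t - 2 * r <= `|w n|.
  by have := ler_normD a (w n); have := aw n; lra.
have v_ge n : s - 2 * r <= `|v n|.
  have [_ [_]] := hN _ (NN n); have := w_le n.
  have := ler_normB (w n) (v n).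
  by rewrite {2}/v opprB addrC subrK; lra.
have av n : `|a + v n| <= s + r.
  have [[_]] := hN _ (NN n); suff -> : a + v n = z (n + N)%N - x (n + N)%N by [].
  have aw' : a + w n = z (n + N)%N - q by rewrite addrC /w /a addrA subrK.
  by rewrite /v addrA aw' opprB addrA subrK.
pose a1 := `|a|^-1 *: a.
have a11 : unit_sphere X a1.
  by rewrite /unit_sphere /= normrZ normfV normr_id mulVf // gt_eqF.
have a1E (k : R) (y : X) : `|a1 + k *: y| = `|a + (k * `|a|) *: y| / `|a|.
  have -> : a1 + k *: y = `|a|^-1 *: (a + (k * `|a|) *: y).
    by rewrite scalerDr scalerA mulrCA mulVf ?gt_eqF // mulr1.
  by rewrite normrZ normfV normr_id mulrC.
have [dt|bt] := NC a1 a11.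
- have sr0 : 0 < s - 2 * r by lra.
  have := d_modulus_le _ a1 2^-1 (1 + t / 2) a11
    (normalized_null_seq v _ sr0 v_ge v0).
  have step n : `|a1 + 2^-1 *: (`|v n|^-1 *: v n)| <= 1 + t / 2.
    rewrite a1E ler_pdivrMr // scalerA.
    have v1 : 0 < `|v n| by exact: lt_le_trans (v_ge n).
    (* a + k v n is a convex combination of a and a + v n *)
    set k := _ / `|v n|.
    have k0 : 0 <= k by rewrite divr_ge0 // mulr_ge0.
    have k1 : k <= 1 by rewrite /k ler_pdivrMr // mul1r; have := v_ge n; lra.
    clearbody k; have -> : a + k *: v n = (1 - k) *: a + k *: (a + v n).
      by rewrite [k *: (a + _)]scalerDr addrA -scalerDl subrK scale1r.
    have : `|(1 - k) *: a + k *: (a + v n)| <= s + r.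
      apply: le_trans (ler_normD _ _) _; rewrite !normrZ !ger0_norm ?subr_ge0 //.
      have := ler_wpM2l k0 (av n).
      have k10 : 0 <= 1 - k by rewrite subr_ge0.
      have := ler_wpM2l k10 a_le; lra.
    have t20 : 0 <= 1 + t / 2 by lra.
    have := ler_wpM2l t20 a_ge; lra.
  move/(_ step)/(le_trans dt); rewrite lee_fin; lra.
- have str0 : 0 < s * t - 2 * r by lra.
  have := b_modulus_ge _ a1 t (1 + 3 / 4 * t) a11
    (normalized_null_seq w _ str0 w_ge w0).
  have step n : 1 + 3 / 4 * t <= `|a1 + t *: (`|w n|^-1 *: w n)|.
    rewrite a1E ler_pdivlMr // scalerA.
    have w1 : 0 < `|w n| by exact: lt_le_trans (w_ge n).
    set k := _ / `|w n|.
    (* k is close to 1, as the norm of w n is about t times that of a *)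
    have D : `|w n - k *: w n| <= (2 + 2 * t) * r.
      have -> : w n - k *: w n = (1 - k) *: w n by rewrite scalerBl scale1r.
      rewrite normrZ -[`|w n| in X in X <= _]normr_id -normrM mulrBl mul1r divfK ?gt_eqF //.
      have := w_le n; have := w_ge n.
      have := ler_wpM2l (ltW t0) a_le; have := ler_wpM2l (ltW t0) a_ge.
      by rewrite ler_norml => *; apply/andP; split; lra.
    have := ler_distD (a + k *: w n) (a + w n) 0; rewrite !subr0.
    have -> : a + w n - (a + k *: w n) = w n - k *: w n.
      by rewrite opprD addrACA subrr add0r.
    move=> D2.
    have t40 : 0 <= 1 + 3 / 4 * t by lra.
    have := ler_wpM2l t40 a_le; have := aw n; lra.
  move/(_ step) => /le_trans/(_ bt); rewrite lee_fin; lra.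
Qed.
End Noncreasy.

(** * The fixed point theorem *)
Lemma noncreasy_fixed_point (R : realType) (X : normedModType R) (C : set X)
    (c : R) (T : X -> X) : nearly_uniformly_noncreasy X ->
  C !=set0 -> convex_subset C -> weakly_compact C ->
  (forall x, C x -> C (T x)) -> 0 < c < 1 -> condition_C_ c C T ->
  displacement_closed C T -> exists2 x, C x & T x = x.
Proof.
move=> NUNC C0 Cconv Ccpt CT c01 TC Tcl; apply: contrapT => nofix.
have Ccl := weakly_compact_closed C Ccpt.
have [K [KC K0 Kcl Kconv KT] Kmin] :=
  minimal_invariant_subset C T Ccpt (And5 (fun x Cx => Cx) C0 Ccl Cconv CT).
have [M CM] := weakly_compact_bounded C Ccpt.
have Kd y z : K y -> K z -> `|y - z| <= 2 * M.
  move=> /KC Cy /KC Cz; have := ler_normB y z.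
  by have := CM y Cy; have := CM z Cz; lra.
have KK : invariant_subset K T K by split.
have {}Kmin D : D `<=` K -> invariant_subset K T D -> D = K.
  move=> DK [_ ? ? ? ?]; apply: Kmin => //; split=> //.
  exact: subset_trans KC.
have {}TC : condition_C_ c K T by move=> x y /KC Cx /KC Cy; exact: TC.
have {}Tcl : displacement_closed K T.
  move=> y /KC Cy yu; apply: Tcl => // e /yu[u [/KC Cu uy uT]].
  by exists u.
have {}nofix y : K y -> T y <> y.
  by move=> /KC Cy Ty; apply: nofix; exists y.
have [rho [x ax xball] xlow] := minimal_radius c (2 * M) K T c01 KK Kmin Kd TC Tcl.
have rho0 := minimal_radius_gt0 K T KK rho x nofix ax xball.
have [phi [nphi [q Cq xq]]] :=
  weakly_compact_sequential C x Ccpt (fun n => KC _ (ax.1 n)).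
have sub (P : nat -> Prop) (f : nat -> nat) : (forall n, (n <= f n)%N) ->
    (\forall n \near \oo, P n) -> \forall n \near \oo, P (f n).
  by move=> nf [N _ NP]; exists N => // n Nn; apply: NP; exact: leq_trans (nf n).
pose x1 n := x (phi n).
have x1K n : K (x1 n) by exact: ax.1.
have x1T (e : R) : 0 < e -> \forall n \near \oo, `|x1 n - T (x1 n)| <= e.
  by move=> e0; apply: (sub (fun n => `|x n - T (x n)| <= e) phi nphi); exact: ax.2.
have x1_le y (e : R) : K y -> 0 < e -> \forall n \near \oo, `|x1 n - y| <= rho + e.
  by move=> Ky e0; apply: (sub (fun n => `|x n - y| <= rho + e) phi nphi);
     exact: (xball y Ky).2.
have x1_ge y (e : R) : K y -> 0 < e -> \forall n \near \oo, rho - e <= `|x1 n - y|.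
  move=> Ky e0; have [r r0 hr] := xlow y e Ky e0.
  by apply: filterS (x1T r r0) => n; exact: hr.
have Kq : K q.
  by apply: (weakly_cvg_convex K x1 q Kconv Kcl) => //; exact: nearW.
case: NUNC => [schur|NC].
  have x1cvg : cvgn x1 by apply: schur; exists q.
  have [m /cvg_normP x1m] : exists m : X, x1 @ \oo --> m by exists (limn x1).
  have Km : K m.
    apply: (weakly_cvg_convex K x1 m Kconv Kcl); [exact: nearW|].
    exact: cvg_weakly ((cvg_normP x1 m).2 x1m).
  apply: (nofix m Km); apply: Tcl => // e e0.
  have e20 : 0 < e / 2 by rewrite divr_gt0.
  have [n [nm nT]] := filter_ex (filterI (x1m e e0) (x1T _ e20)).
  by exists (x1 n); split=> //; apply: le_lt_trans nT _; lra.
have [t t0 NCt] := NC 2^-1 ltac:(by rewrite invr_gt0).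
have t1 : 0 < 1 + t by lra.
(* the ratio of rho - s to s must be the t of the noncreasiness condition *)
pose s := rho / (1 + t).
have s0 : 0 < s by rewrite divr_gt0.
have st0 : 0 < s * t by rewrite mulr_gt0.
have sE : s * (1 + t) = rho by rewrite divfK // gt_eqF.
pose r := s * t / (16 * (1 + t)).
have r0 : 0 < r by rewrite divr_gt0 // mulr_gt0.
have rE : 16 * ((1 + t) * r) = s * t.
  have d0 : 0 < 16 * (1 + t) by lra.
  by rewrite mulrA mulrC /r divfK // gt_eqF.
have tr0 : 0 < t * r by rewrite mulr_gt0.
have rs : 16 * r <= s.
  by rewrite -(ler_pM2r t1); lra.
have [b b0 zlow] := xlow q r Kq r0.
have e0 : 0 < Num.min b r by rewrite lt_min b0.
have strho : 0 < s * t <= rho by rewrite st0 /= -sE; lra.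
have [z [zK zT zz zx]] := spread_all c (2 * M) rho K T x1 c01 Kconv KT Kd TC
  x1K x1T x1_le x1_ge rho0 (s * t) strho _ e0.
have [psi [npsi [l Cl zl]]] :=
  weakly_compact_sequential C z Ccpt (fun n => KC _ (zK n)).
apply: (noncreasy_spread_false t s r (x1 \o psi) (z \o psi) q l t0 NCt s0 r0) => //.
- by rewrite rE.
- exact: weakly_cvg_sub npsi xq.
- apply: (sub (fun n => \forall m \near \oo, `|z n - z (psi m)| <= s * t + r) psi npsi).
  apply: filterS zz => n zn; apply: (sub (fun m => `|z n - z m| <= s * t + r) psi npsi).
  apply: filterS zn => m h; apply: le_trans h _.
  by rewrite lerD2l ge_min lexx orbT.
- apply: (sub (fun n => `|z n - x1 n| <= s + r) psi npsi).
  apply: filterS zx => n h; apply: le_trans h _.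
  by apply: lerD; [rewrite -sE; lra|rewrite ge_min lexx orbT].
- apply: (sub (fun n => s * (1 + t) - r <= `|z n - q|) psi npsi); rewrite sE.
  apply: filterS zT => n h; apply: zlow => //; apply: le_trans h _.
  by rewrite ge_min lexx.
- apply: (sub (fun n => s * (1 + t) - r <= `|x1 n - q|) psi npsi); rewrite sE.
  exact: x1_ge.
Qed.

Theorem theorem4p2 (R : realType) (X : completeNormedModType R) (C : set X) :
  nearly_uniformly_noncreasy X ->
  C !=set0 -> convex_set (C : set (convex_lmodType X)) -> weakly_compact C ->
  (forall T : X -> X, set_fun C C T -> {within C, continuous T} ->
     (exists2 lambda : R, 0 < lambda < 1 & condition_C_ lambda C T) ->
     exists2 x, C x & T x = x) /\
  (forall T : X -> X, set_fun C C T -> condition_C C T ->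
     exists2 x, C x & T x = x).
Proof.
move=> NUNC C0 /convex_setP Cconv Ccpt; split=> T CT.
  move=> Tcont [c c01 TC]; apply: (noncreasy_fixed_point _ _ C c) => //.
  exact: within_continuous_displacement_closed.
move=> TC; apply: (noncreasy_fixed_point _ _ C 2^-1) => //.
  by apply/andP; split; [rewrite invr_gt0|rewrite invf_lt1 // ltr1n].
exact: condition_C_displacement_closed.
Qed.
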